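(* Let $M$ be an invariant submanifold of an $(LCS)_n$-manifold $\widetilde{M}$ admitting quarter symmetric metric connection, and suppose $\alpha\neq1$ (at every point). Then the second fundamental form $\sigma$ of $M$ is generalized 2-recurrent with respect to the quarter symmetric metric connection if and only if $M$ is totally geodesic with respect to the Levi-Civita connection.
   Context: An $(LCS)_n$-manifold (Lorentzian concircular structure manifold) is an $n$-dimensional Lorentzian manifold $(\widetilde{M},g)$, signature $(-,+,\dots,+)$, with Levi-Civita connection $\widetilde{\nabla}$, together with a unit timelike vector field $\xi$ (so $g(\xi,\xi)=-1$), the 1-form $\eta(X)=g(X,\xi)$, and a nowhere zero smooth function $\alpha$ such that $\widetilde{\nabla}_X\xi=\alpha\{X+\eta(X)\xi\}$, equivalently $(\widetilde{\nabla}_X\eta)(Y)=\alpha\{g(X,Y)+\eta(X)\eta(Y)\}$, and $X\alpha=\rho\,\eta(X)$ for all $X$, where $\rho=-(\xi\alpha)$. The structure tensor is the $(1,1)$ tensor $\phi X=\frac1\alpha\widetilde{\nabla}_X\xi=X+\eta(X)\xi$. The quarter symmetric metric connection on $\widetilde{M}$ is $\overline{\widetilde{\nabla}}_XY=\widetilde{\nabla}_XY+\eta(Y)\phi X-g(\phi X,Y)\xi$. A submanifold $M$ of dimension $m<n$ with induced metric (also denoted $g$) is invariant if $\xi$ is tangent to $M$ at every point of $M$ and $\phi(TM)\subset TM$. For $X,Y$ tangent to $M$: $\widetilde{\nabla}_XY=\nabla_XY+\sigma(X,Y)$ (tangential and normal parts), where $\sigma$ is the second fundamental form; $\overline{\nabla}_XY$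 is the tangential part of $\overline{\widetilde{\nabla}}_XY$; and for $V$ normal, $\overline{\nabla}^\perp_XV$ is the normal part of $\overline{\widetilde{\nabla}}_XV$. $M$ is totally geodesic with respect to the Levi-Civita connection if $\sigma=0$. First and second covariant derivatives of $\sigma$ with respect to the quarter symmetric metric connection, for vector fields $X,Y,Z,W$ tangent to $M$: $(\overline{\widetilde{\nabla}}_X\sigma)(Y,Z)=\overline{\nabla}^\perp_X(\sigma(Y,Z))-\sigma(\overline{\nabla}_XY,Z)-\sigma(Y,\overline{\nabla}_XZ)$, $(\overline{\widetilde{\nabla}}_X\overline{\widetilde{\nabla}}_Y\sigma)(Z,W)=\overline{\nabla}^\perp_X((\overline{\widetilde{\nabla}}_Y\sigma)(Z,W))-(\overline{\widetilde{\nabla}}_Y\sigma)(\overline{\nabla}_XZ,W)-(\overline{\widetilde{\nabla}}_X\sigma)(Z,\overline{\nabla}_YW)-(\overline{\widetilde{\nabla}}_{\overline{\nabla}_XY}\sigma)(Z,W)$. $\sigma$ is generalized 2-recurrent with respect to the quarter symmetric metric connection if there are a $(0,2)$-tensor field $\psi$ and a 1-form $\pi$ on $M$ with $(\overline{\widetilde{\nabla}}_X\overline{\widetilde{\nabla}}_Y\sigma)(Z,W)=\psi(X,Y)\sigma(Z,W)+\pi(X)(\overline{\widetilde{\nabla}}_Y\sigma)(Z,W)$ for all vector fields $X,Y,Z,W$ tangent to $M$. *)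

(* Defs.v *)
From HB Require Import structures.
From mathcomp Require Import all_boot all_order all_algebra.
From mathcomp Require Import all_classical all_reals all_analysis.
Set Implicit Arguments.
Unset Strict Implicit.
Unset Printing Implicit Defensive.
Import Order.TTheory GRing.Theory Num.Theory.
Import numFieldNormedType.Exports.
Local Open Scope classical_set_scope.
Local Open Scope ring_scope.

(* C^k on A; [differentiable] is Fréchet differentiability. Meant for open A. *)
Fixpoint Ck (R : realType) (V W : normedModType R) (k : nat) (A : set V)
    (f : V -> W) : Prop :=
  match k with
  | 0%N => forall x, A x -> {for x, continuous f}
  | k'.+1 => (forall x, A x -> differentiable f x) /\
             (forall v, Ck k' A (fun x => 'D_v f x))
  end.

Definition Cinfty (R : realType) (V W : normedModType R) (A : set V)
  (f : V -> W) : Prop := forall k, Ck k A f.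

(* [chart_inv i] is only meaningful on [chart i @` dom i].  As every point is
   covered by a chart, one such chart [chart_at p] is singled out for each p. *)
Record smooth_manifold (R : realType) (n : nat) := SmoothManifold {
  carrier :> topologicalType ;
  chart_index : Type ;
  dom : chart_index -> set carrier ;
  chart : chart_index -> carrier -> 'rV[R]_n ;
  chart_inv : chart_index -> 'rV[R]_n -> carrier ;
  chart_at : carrier -> chart_index ;
  manifold_hausdorff : hausdorff_space carrier ;
  manifold_second_countable : @second_countable carrier ;
  dom_open : forall i, open (dom i) ;
  mem_chart_at : forall p, dom (chart_at p) p ;
  chart_image_open : forall i, open (chart i @` dom i) ;
  chartK : forall i p, dom i p -> chart_inv i (chart i p) = p ;
  chart_continuous : forall i p, dom i p -> {for p, continuous (chart i)} ;
  chart_inv_continuous : forall i p, dom i p ->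
    {for chart i p, continuous (chart_inv i)} ;
  transition_smooth : forall i j,
    Cinfty (chart i @` (dom i `&` dom j)) (chart j \o chart_inv i)
}.

Section Manifold.
Context {R : realType} {n : nat} (M : smooth_manifold R n).

(* Tangent space: T_pM is 'rV[R]_n, a vector v being given by its components
   in the chart [chart_at p].  A vector field is thus a function M -> 'rV[R]_n;
   it need not have continuous values, since [chart_at] jumps: smoothness is
   always tested on the components in a fixed chart ([smooth_vf]). *)

(* v(f) for v in T_pM *)
Definition vder {W : normedModType R} (p : M) (v : 'rV[R]_n) (f : M -> W) : W :=
  'D_v (f \o chart_inv (chart_at p)) (chart (chart_at p) p).

(* The components of v in a chart i around p are v(chart i). *)
Definition comp (i : chart_index M) (p : M) (v : 'rV[R]_n) : 'rV[R]_n :=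
  vder p v (chart i).

Definition smooth_on {W : normedModType R} (U : set M) (f : M -> W) : Prop :=
  forall i, Cinfty (chart i @` (dom i `&` U)) (f \o chart_inv i).

Definition smooth_vf (U : set M) (X : M -> 'rV[R]_n) : Prop :=
  forall i, smooth_on (dom i `&` U) (fun p => comp i p (X p)).

(* coordinate field d/dx^k of the chart i, meaningful on dom i *)
Definition coord_vf (i : chart_index M) (k : 'I_n) (p : M) : 'rV[R]_n :=
  'D_(delta_mx 0 k) (chart (chart_at p) \o chart_inv i) (chart i p).

Definition lie_bracket (X Y : M -> 'rV[R]_n) (p : M) : 'rV[R]_n :=
  let i := chart_at p in
  vder p (X p) (fun q => comp i q (Y q)) - vder p (Y p) (fun q => comp i q (X q)).

Definition one_form (w : M -> 'rV[R]_n -> R) : Prop :=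
  (forall p, scalar (w p)) /\
  (forall U X, open U -> smooth_vf U X -> smooth_on U (fun p => w p (X p))).

Definition tensor02 (b : M -> 'rV[R]_n -> 'rV[R]_n -> R) : Prop :=
  (forall p u, scalar (b p u)) /\ (forall p u, scalar (b p ^~ u)) /\
  (forall U X Y, open U -> smooth_vf U X -> smooth_vf U Y ->
     smooth_on U (fun p => b p (X p) (Y p))).

Definition lorentzian_metric (g : M -> 'rV[R]_n -> 'rV[R]_n -> R) : Prop :=
  tensor02 g /\ (forall p u v, g p u v = g p v u) /\
  (forall p, exists P : 'M[R]_n, P \in unitmx /\
     forall a b : 'I_n, g p (row a P) (row b P) =
       if a == b then (if val a == 0%N then -1 else 1) else 0).

(* An affine connection, as an operator on vector fields that only have to be
   smooth around the point p: D p v Y is the derivative of Y along v in T_pM. *)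
Definition connection := M -> 'rV[R]_n -> (M -> 'rV[R]_n) -> 'rV[R]_n.

Definition affine_connection (D : connection) : Prop :=
  [/\ forall U p Y, open U -> U p -> smooth_vf U Y -> linear (fun v => D p v Y),
      forall U p v Y Z, open U -> U p -> smooth_vf U Y -> smooth_vf U Z ->
        D p v (fun q => Y q + Z q) = D p v Y + D p v Z,
      forall U p v (f : M -> R) Y, open U -> U p ->
        smooth_on U f -> smooth_vf U Y ->
        D p v (fun q => f q *: Y q) = vder p v f *: Y p + f p *: D p v Y &
      forall U X Y, open U -> smooth_vf U X -> smooth_vf U Y ->
        smooth_vf U (fun p => D p (X p) Y)].

Definition levi_civita (g : M -> 'rV[R]_n -> 'rV[R]_n -> R) (D : connection)
    : Prop :=
  [/\ affine_connection D,
      forall U p X Y, open U -> U p -> smooth_vf U X -> smooth_vf U Y ->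
        D p (X p) Y - D p (Y p) X = lie_bracket X Y p &
      forall U p v Y Z, open U -> U p -> smooth_vf U Y -> smooth_vf U Z ->
        vder p v (fun q => g q (Y q) (Z q)) =
        g p (D p v Y) (Z p) + g p (Y p) (D p v Z)].

Section LCS.
Variables (g : M -> 'rV[R]_n -> 'rV[R]_n -> R) (D : connection).
Variables (xi : M -> 'rV[R]_n) (alpha : M -> R).

Definition eta (p : M) (v : 'rV[R]_n) : R := g p v (xi p).

Definition phi (p : M) (v : 'rV[R]_n) : 'rV[R]_n := v + eta p v *: xi p.

Definition rho (p : M) : R := - vder p (xi p) alpha.

Definition lcs_manifold : Prop :=
  [/\ lorentzian_metric g, levi_civita g D,
      smooth_vf setT xi /\ (forall p, g p (xi p) (xi p) = -1),
      smooth_on setT alpha /\ (forall p, alpha p != 0) &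
      (forall p v, D p v xi = alpha p *: (v + eta p v *: xi p)) /\
      (forall p v, vder p v alpha = rho p * eta p v)].

Definition quarter_symmetric : connection := fun p v Y =>
  D p v Y + eta p (Y p) *: phi p v - g p (phi p v) (Y p) *: xi p.

End LCS.
End Manifold.

Arguments smooth_vf {R n M} U X.
Arguments coord_vf {R n M} i k p.

Section Submanifold.
Context {R : realType} {n m : nat}.
Variables (N : smooth_manifold R n) (M : smooth_manifold R m) (F : M -> N).

Definition smooth_map : Prop :=
  continuous F /\ forall j, smooth_on (F @^-1` dom j) (chart j \o F).

Definition tangent_map (p : M) (v : 'rV[R]_m) : 'rV[R]_n :=
  vder p v (chart (chart_at (F p)) \o F).

Definition immersion : Prop := smooth_map /\ forall p, injective (tangent_map p).

(* Derivative of a vector field V along F (V q in T_(F q)N) in the direction v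
   in T_pM, for the connection induced by D on the pull-back bundle: if
   V = \sum_k V^k (d_k \o F) around p, with the d_k the coordinate fields of a
   chart at F p, this is \sum_k (v(V^k) d_k + V^k D_(dF v) d_k).  When
   V = Y \o F for a field Y of N it is D_(dF v) Y, so this is the usual
   derivative computed by local extension to N. *)
Definition pullback_derivative (D : connection N) (p : M) (v : 'rV[R]_m)
    (V : M -> 'rV[R]_n) : 'rV[R]_n :=
  let j := chart_at (F p) in
  vder p v (fun q => comp j (F q) (V q)) +
  \sum_(k < n) V p 0 k *: D (F p) (tangent_map p v) (coord_vf j k).

Variable g : N -> 'rV[R]_n -> 'rV[R]_n -> R.

Definition is_tangent (p : M) (w : 'rV[R]_n) : Prop :=
  exists v, w = tangent_map p v.

Definition is_normal (p : M) (w : 'rV[R]_n) : Prop :=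
  forall v, g (F p) (tangent_map p v) w = 0.

(* Tangential part, as an element of T_pM; it is unique when the induced metric
   is nondegenerate, e.g. when some timelike vector is tangent to M at p. *)
Definition tan_part (p : M) (w : 'rV[R]_n) : 'rV[R]_m :=
  xget 0 [set v | is_normal p (w - tangent_map p v)].

Definition nor_part (p : M) (w : 'rV[R]_n) : 'rV[R]_n :=
  w - tangent_map p (tan_part p w).

Definition push (X : M -> 'rV[R]_m) (p : M) : 'rV[R]_n := tangent_map p (X p).

Variables (D : connection N) (xi : N -> 'rV[R]_n).

Definition invariant_submanifold : Prop :=
  [/\ immersion, forall p, is_tangent p (xi (F p)) &
      forall p v, is_tangent p (phi g xi (F p) (tangent_map p v))].

Definition sigma (X Y : M -> 'rV[R]_m) (p : M) : 'rV[R]_n :=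
  nor_part p (pullback_derivative D p (X p) (push Y)).

Definition totally_geodesic : Prop :=
  forall X Y, smooth_vf setT X -> smooth_vf setT Y -> forall p, sigma X Y p = 0.

Let Dq : connection N := quarter_symmetric g D xi.

Definition q_nabla (X Y : M -> 'rV[R]_m) (p : M) : 'rV[R]_m :=
  tan_part p (pullback_derivative Dq p (X p) (push Y)).

Definition q_nabla_perp (X : M -> 'rV[R]_m) (V : M -> 'rV[R]_n) (p : M)
    : 'rV[R]_n :=
  nor_part p (pullback_derivative Dq p (X p) V).

Definition q_Dsigma (X Y Z : M -> 'rV[R]_m) (p : M) : 'rV[R]_n :=
  q_nabla_perp X (sigma Y Z) p - sigma (q_nabla X Y) Z p
  - sigma Y (q_nabla X Z) p.

(* The third correction term is (D_X sigma)(Z, nabla_Y W), as in the source. *)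
Definition q_D2sigma (X Y Z W : M -> 'rV[R]_m) (p : M) : 'rV[R]_n :=
  q_nabla_perp X (q_Dsigma Y Z W) p
  - q_Dsigma Y (q_nabla X Z) W p
  - q_Dsigma X Z (q_nabla Y W) p
  - q_Dsigma (q_nabla X Y) Z W p.

Definition generalized_2_recurrent : Prop :=
  exists (psi : M -> 'rV[R]_m -> 'rV[R]_m -> R) (pi1 : M -> 'rV[R]_m -> R),
    tensor02 psi /\ one_form pi1 /\
    forall X Y Z W, smooth_vf setT X -> smooth_vf setT Y ->
      smooth_vf setT Z -> smooth_vf setT W -> forall p,
      q_D2sigma X Y Z W p =
      psi p (X p) (Y p) *: sigma Z W p + pi1 p (X p) *: q_Dsigma Y Z W p.

End Submanifold.

(* Main.v *)
(* Put Z = W = xi in the recurrence. Since nabla_X xi = alpha (X + eta(X) xi) is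
   tangent to M, sigma(X, xi) = 0, and nablabar_X xi = (alpha - 1)(X + eta(X) xi)
   for the tangential part nablabar of the quarter symmetric connection. As sigma
   is symmetric, the right-hand side vanishes and the left-hand side reduces to
   2 sigma(nablabar_X xi, nablabar_Y xi) = 2 (alpha - 1)^2 sigma(X, Y), whence
   sigma = 0. Conversely, for sigma = 0 both sides vanish with psi = pi = 0.

   Fields built with nablabar are fed back into sigma, so they must be smooth:
   the tangential part is given in a chart by the inverse of the Gram matrix of
   the coordinate fields, which is invertible because T_pM contains the timelike
   vector xi, whose orthogonal complement is definite. Symmetry of sigma rests on
   the vanishing torsion and on the symmetry of second derivatives. *)

Require Import Defs.
From HB Require Import structures.
From mathcomp Require Import all_boot all_order all_algebra.
From mathcomp Require Import all_classical all_reals all_analysis.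
From mathcomp Require Import ring.

Set Implicit Arguments.
Unset Strict Implicit.
Unset Printing Implicit Defensive.
Import Order.TTheory GRing.Theory Num.Theory.
Import numFieldNormedType.Exports.
(* Imported last, so that [comp] is not ssrfun's. *)
Import Defs.
Local Open Scope classical_set_scope.
Local Open Scope ring_scope.

(** The factor (alpha - 1)^2 comes from two sources: [D] contributes alpha phi(X) to the derivative
    of xi, and the quarter symmetric term adds eta(xi) phi(X) = - phi(X), while g(phi(X), xi) = 0.
    The factor 2 counts the two corrections of the second derivative in which one xi has been
    differentiated; the normal derivative itself is only taken of sections that vanish identically.

    The encoding of vectors shapes the development: they are components in a chart that jumps with
    the point, so a field cannot be differentiated as a vector-valued function. The work is done on
    components in a fixed chart, or on expansions in its coordinate fields, and sections along F are
    treated apart from fields of N, since they need not extend. Linearity of sigma is obtained in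
    the first slot, where it is pointwise; the second slot is reached by symmetry, which holds for
    smooth fields. This is where the smoothness of the fields built with nablabar enters. *)

Section Calculus.
Context {R : realType}.
Implicit Types V W X : normedModType R.

(** * Differentials, the product rule and the chain rule *)

Lemma near_eq_is_diff V W (f g df : V -> W) x :
  {near x, f =1 g} -> is_diff x f df -> is_diff x g df.
Proof.
move=> fg [df1 <-].
have [dfc dfo] := (diff_locallyP _ _).1 df1.
have H : g \o shift x = cst (g x) + 'd f x +o_ 0 id.
  have N1 : \forall h \near 0, f (h + x) = g (h + x).
    move: fg; rewrite (near_shift 0) /=.
    by apply: filterS => y; rewrite subr0.
  apply/eqaddoP => e e0.
  have N2 := (eqaddoP _ _ _ _).1 dfo e e0.
  apply: filterS2 N1 N2 => h; rewrite !fctE /= => <-.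
  by rewrite -(nbhs_singleton fg).
have E := diff_unique dfc H.
have dg : differentiable g x by apply/diff_locallyP; rewrite E.
exact: DiffDef dg E.
Qed.

Lemma near_eq_differentiable V W (f g : V -> W) x :
  {near x, f =1 g} -> differentiable f x -> differentiable g x.
Proof. by move=> fg /differentiableP /(near_eq_is_diff fg) []. Qed.

Lemma scale_is_bilinear W :
  bilinear_for (GRing.Scale.Law.clone _ _ *:%R _) (GRing.Scale.Law.clone _ _ *:%R _)
    (@GRing.scale R W).
Proof.
split=> [u'|u] a x y /=.
- by rewrite scalerDl scalerA.
- by rewrite scalerDr !scalerA (mulrC u).
Qed.

HB.instance Definition _ W := bilinear_isBilinear.Build R R W W _ _
  (@GRing.scale R W) (@scale_is_bilinear W).

(** The chain rule for y |-> (f y, g y) followed by scaling, a continuous bilinear map whose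
    differential is known. *)
Lemma is_diff_scale V W (f : V -> R) (g : V -> W) x :
  differentiable f x -> differentiable g x ->
  is_diff x (fun y => f y *: g y) (fun v => f x *: 'd g x v + 'd f x v *: g x).
Proof.
move=> df dg.
have sc : continuous (fun p : R * W => p.1 *: p.2) by exact: scale_continuous.
have hd : is_diff (f x, g x) (fun p : R * W => p.1 *: p.2)
   (fun q => f x *: q.2 + q.1 *: g x).
  apply: DiffDef; first by exact: (@differentiable_bilin _ _ _ _ (@GRing.scale R W)).
  by rewrite (@diff_bilin _ _ _ _ (@GRing.scale R W)).
exact: (@is_diff_comp _ _ _ _ (fun y => (f y, g y)) _ _ _ x
  (is_diff_pair (differentiableP df) (differentiableP dg)) hd).
Qed.

Lemma differentiable_scale V W (f : V -> R) (g : V -> W) x :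
  differentiable f x -> differentiable g x ->
  differentiable (fun y => f y *: g y) x.
Proof. by move=> df dg; case: (is_diff_scale df dg). Qed.

Lemma derive_scale V W (f : V -> R) (g : V -> W) x v :
  differentiable f x -> differentiable g x ->
  'D_v (fun y => f y *: g y) x = 'D_v f x *: g x + f x *: 'D_v g x.
Proof.
move=> df dg; have [d e] := is_diff_scale df dg.
by rewrite !deriveE // e addrC.
Qed.

Lemma derive_comp V W X (f : V -> W) (h : W -> X) x y v :
  differentiable f x -> f x = y -> differentiable h y ->
  'D_v (h \o f) x = 'D_('D_v f x) h y.
Proof.
move=> df <- dh; rewrite !deriveE //; last exact: differentiable_comp.
by rewrite diff_comp.
Qed.

Lemma derive_linear V W (f : V -> W) x : differentiable f x ->
  linear (fun v => 'D_v f x).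
Proof. by move=> df a u v; rewrite !deriveE // linearP. Qed.

Lemma derive_row n W (f : 'rV[R]_n -> W) x v : differentiable f x ->
  'D_v f x = \sum_k v 0 k *: 'D_(delta_mx 0 k) f x.
Proof.
move=> df; rewrite deriveE // {1}(row_sum_delta v) linear_sum.
by apply: eq_bigr => k _; rewrite linearZ deriveE.
Qed.

Lemma derive_lfun V W X (L : {linear W -> X}) (f : V -> W) x v :
  continuous L -> differentiable f x -> 'D_v (L \o f) x = L ('D_v f x).
Proof.
move=> Lc df; rewrite (@derive_comp _ _ _ _ _ _ (f x)) //; last first.
  exact: linear_differentiable.
by rewrite deriveE ?diff_lin //; exact: linear_differentiable.
Qed.

(** * Smooth functions on open sets of normed spaces *)

Lemma Ck_subset V W k (A B : set V) (f : V -> W) :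
  A `<=` B -> Ck k B f -> Ck k A f.
Proof.
move=> AB; elim: k f => [|k IH] f /= fB; first by move=> x /AB; exact: fB.
by case: fB => fB dfB; split=> [x /AB|v]; [exact: fB|exact/IH/dfB].
Qed.

(** Each clause of [Ck] is tested at single points of the set, so smoothness glues over a cover. *)
Lemma Ck_local V W k (A : set V) (f : V -> W) :
  (forall x, A x -> exists2 B : set V, B x & Ck k B f) -> Ck k A f.
Proof.
elim: k f => [|k IH] f /= H.
  by move=> x /H [B Bx]; apply.
split=> [x /H [B Bx []]|v]; first by move=> + _; apply.
by apply: IH => x /H [B Bx [_ dB]]; exists B.
Qed.

(** On an open set, equality on A is equality near each point of A, so it passes to the directional
    derivatives and the induction continues with these. *)
Lemma eq_Ck V W k (A : set V) (f g : V -> W) : open A ->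
  {in A, f =1 g} -> Ck k A f -> Ck k A g.
Proof.
move=> oA; have nE (f' g' : V -> W) x : A x -> {in A, f' =1 g'} ->
    {near x, f' =1 g'}.
  move=> Ax fg; near=> y; apply: fg; rewrite inE; near: y.
  exact: open_nbhs_nbhs.
elim: k f g => [|k IH] f g /= fg.
  move=> fc x Ax; have /nE - /(_ _ Ax) nfg := fg.
  rewrite /prop_for /continuous_at -(nbhs_singleton nfg).
  exact: cvg_trans (near_eq_cvg nfg) (fc _ Ax).
case=> df dDf; split=> [x Ax|v].
  by apply: near_eq_differentiable (df _ Ax); exact: nE.
apply: IH (dDf v) => x; rewrite inE => Ax.
by apply: near_eq_derive; exact: nE.
Unshelve. all: by end_near. Qed.

Lemma CkSW V W k (A : set V) (f : V -> W) : Ck k.+1 A f -> Ck k A f.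
Proof.
elim: k f => [|k IH] f [df dDf].
  by move=> x Ax; exact/differentiable_continuous/df.
by split=> // v; exact/IH/dDf.
Qed.

Lemma Ck_cst V W k (A : set V) (c : W) : Ck k A (fun=> c).
Proof.
elim: k c => [|k IH] c; first by move=> x _; exact: cst_continuous.
split=> [x _|v]; first exact: differentiable_cst.
have -> : (fun x => 'D_v (fun=> c) x) = fun=> (0 : W).
  by apply/funext => x; exact: derive_cst.
exact: IH.
Qed.

Lemma CkD V W k (A : set V) (f g : V -> W) : open A ->
  Ck k A f -> Ck k A g -> Ck k A (fun x => f x + g x).
Proof.
move=> oA; elim: k f g => [|k IH] f g.
  by move=> cf cg x Ax; apply: continuousD; [exact: cf|exact: cg].
move=> [df dDf] [dg dDg]; split=> [x Ax|v].
  by apply: differentiableD; [exact: df|exact: dg].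
apply: eq_Ck (IH _ _ (dDf v) (dDg v)) => // x; rewrite inE => Ax /=.
by rewrite -deriveD //; apply: diff_derivable; [exact: df|exact: dg].
Qed.

Lemma Ck_scale V W k (A : set V) (f : V -> R) (g : V -> W) : open A ->
  Ck k A f -> Ck k A g -> Ck k A (fun x => f x *: g x).
Proof.
move=> oA; elim: k f g => [|k IH] f g.
  move=> cf cg x Ax; apply: (@continuousZ _ _ _ f g); [exact: cf|exact: cg].
move=> cf cg; have [df dDf] := cf; have [dg dDg] := cg; split=> [x Ax|v].
  by apply: differentiable_scale; [exact: df|exact: dg].
(* Product rule: in each summand one factor is differentiated, and the other gives up one order to
   meet the induction hypothesis. *)
apply: eq_Ck (CkD oA (IH _ _ (dDf v) (CkSW cg)) (IH _ _ (CkSW cf) (dDg v))) => //.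
move=> x; rewrite inE => Ax /=.
by rewrite -derive_scale //; [exact: df|exact: dg].
Qed.

Lemma Ck_sum V W k (A : set V) I (r : seq I) (P : pred I) (f : I -> V -> W) :
  open A -> (forall i, P i -> Ck k A (f i)) ->
  Ck k A (fun x => \sum_(i <- r | P i) f i x).
Proof.
move=> oA Cf; elim: r => [|i r IH].
  by under eq_fun do rewrite big_nil; exact: Ck_cst.
under eq_fun do rewrite big_cons.
case: (boolP (P i)) => [Pi|_]; last exact: IH.
by apply: CkD => //; exact: Cf.
Qed.

Lemma Ck_lfun V W X k (A : set V) (L : {linear W -> X}) (f : V -> W) :
  open A -> continuous L -> Ck k A f -> Ck k A (fun x => L (f x)).
Proof.
move=> oA Lc; elim: k f => [|k IH] f.
  by move=> cf x Ax; apply: continuous_comp; [exact: cf|exact: Lc].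
move=> [df dDf]; split=> [x Ax|v].
  apply: (@differentiable_comp _ _ _ _ f L); first exact: df.
  exact: linear_differentiable.
apply: eq_Ck (IH _ (dDf v)) => // x; rewrite inE => Ax /=.
by rewrite -derive_lfun //; exact: df.
Qed.

Lemma Ck_coord V n k (A : set V) (f : V -> 'rV[R]_n) j :
  open A -> Ck k A f -> Ck k A (fun x => f x 0 j).
Proof.
move=> oA Cf.
have @L : {linear 'rV[R]_n -> R}.
  by exists (fun N : 'rV[R]_n => N 0 j); do 2![eexists]; do ?[constructor];
     rewrite ?mxE// => ? *; rewrite ?mxE//; move=> ?; rewrite !mxE.
apply: (@Ck_lfun _ _ _ _ _ L) => //; exact: coord_continuous.
Qed.

Lemma Ck_row V n k (A : set V) (f : V -> 'rV[R]_n) :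
  open A -> (forall j, Ck k A (fun x => f x 0 j)) -> Ck k A f.
Proof.
move=> oA Cf; have -> : f = fun x => \sum_j f x 0 j *: delta_mx 0 j.
  by apply/funext => x; exact: row_sum_delta.
by apply: Ck_sum => // j _; apply: Ck_scale => //; exact: Ck_cst.
Qed.

(** The chain rule differentiates h in the moving direction 'D_v f x, while [Ck] controls fixed
    directions. Expanding over the standard basis restores fixed directions, with the coordinates of
    'D_v f as coefficients; hence the middle space of row vectors. *)
Lemma Ck_comp V n W k (A : set V) (B : set 'rV[R]_n) (f : V -> 'rV[R]_n)
    (h : 'rV[R]_n -> W) :
  open A -> (forall x, A x -> B (f x)) ->
  Ck k A f -> Ck k B h -> Ck k A (h \o f).
Proof.
move=> oA AB; elim: k f h AB => [|k IH] f h AB.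
  by move=> cf ch x Ax; apply: continuous_comp; [exact: cf|exact/ch/AB].
move=> cf [dh dDh]; have [df dDf] := cf; split=> [x Ax|v].
  by apply: differentiable_comp; [exact: df|exact/dh/AB].
have H : Ck k A (fun x => \sum_j ('D_v f x) 0 j *: 'D_(delta_mx 0 j) h (f x)).
  apply: Ck_sum => // j _; apply: Ck_scale => //.
    by apply: Ck_coord => //; exact: dDf.
  exact: (IH f _ AB (CkSW cf) (dDh _)).
apply: eq_Ck H => // x; rewrite inE => Ax /=.
rewrite [RHS](@derive_comp _ _ _ _ _ _ (f x)); [|exact: df|by []|exact/dh/AB].
by rewrite [RHS]derive_row //; exact/dh/AB.
Qed.

Lemma CkV V k (A : set V) (f : V -> R) : open A ->
  (forall x, A x -> f x != 0) -> Ck k A f -> Ck k A (fun x => (f x)^-1).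
Proof.
move=> oA f0; elim: k => [|k IH] cf.
  by move=> x Ax; apply: continuousV; [exact: f0|exact: cf].
have Cf := IH (CkSW cf); have [df dDf] := cf; split=> [x Ax|v].
  by apply: differentiableV; [exact: df|exact: f0].
(* The derivative of 1/f is - f^-2 times that of f; the factors 1/f are of class C^k by the
   induction hypothesis. *)
have H : Ck k A (fun x => (-1) *: ((f x)^-1 *: ((f x)^-1 *: 'D_v f x))).
  apply: Ck_scale => //; first exact: Ck_cst.
  by do 2 (apply: Ck_scale => //); exact: dDf.
apply: eq_Ck H => // x; rewrite inE => Ax /=.
have dfx := df _ Ax; have fx := f0 _ Ax.
rewrite [RHS]deriveE; last exact: differentiableV.
by rewrite diffV //= deriveE // scaleN1r !scalerA -invfM -expr2 scaleNr.
Qed.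

End Calculus.

(** * Symmetry of second derivatives *)

Section Schwarz.
Context {R : realType}.
Implicit Types V W : normedModType R.

Lemma is_diff_line V (a u : V) (s : R) :
  is_diff s (fun t : R => t *: u + a) (fun t => t *: u).
Proof.
apply: is_diff_eq.
by apply/funext => t; rewrite fctE addr0.
Qed.

Lemma is_derive_line V W (f : V -> W) (a u : V) (s : R) :
  differentiable f (s *: u + a) ->
  is_derive s 1 (fun t : R => f (t *: u + a)) ('D_u f (s *: u + a)).
Proof.
move=> df; have [dl el] := is_diff_line a u s.
apply: DeriveDef.
  by apply: diff_derivable; exact: (differentiable_comp dl df).
have := @derive_comp _ _ _ _ _ _ _ _ (1 : R) dl erefl df; rewrite /comp => ->.
by rewrite (deriveE _ dl) el scale1r.
Qed.

(** Two applications of the mean value theorem: to s |-> f (s u + h v + x) - f (s u + x), whose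
    increment over [0, h] is the second difference, then to 'D_u f along v. The whole parallelogram
    has to lie in A. *)
Lemma second_difference V (f : V -> R) (A : set V) (x u v : V) (h : R) :
  0 < h -> open A -> Ck 2 A f ->
  (forall s t, 0 <= s <= h -> 0 <= t <= h -> A (s *: u + (t *: v + x))) ->
  exists s t, [/\ 0 <= s <= h, 0 <= t <= h &
    f (h *: u + (h *: v + x)) - f (h *: u + x) - (f (h *: v + x) - f x) =
    'D_v ('D_u f) (s *: u + (t *: v + x)) * h * h].
Proof.
move=> h0 oA [df dDf] HA.
pose p s := f (s *: u + (h *: v + x)) - f (s *: u + x).
pose dp s := 'D_u f (s *: u + (h *: v + x)) - 'D_u f (s *: u + x).
have hh : 0 <= h <= h by rewrite lexx ltW.
have h00 : 0 <= (0 : R) <= h by rewrite lexx ltW.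
have pd s : 0 <= s <= h -> is_derive s 1 p (dp s).
  move=> sh; apply: is_deriveB; apply: is_derive_line; apply: df.
    exact: HA.
  by rewrite -[x]add0r -[0](scale0r v); exact: HA.
have [||s sh] := @MVT R p dp 0 h h0.
- by move=> s; rewrite in_itv /= => /andP[s0 sh]; apply: pd; rewrite !ltW.
- apply: continuous_in_subspaceT => s; rewrite inE /= in_itv /= => /pd ps.
  by apply/differentiable_continuous/derivable1_diffP.
rewrite /p subr0 !scale0r !add0r => ->.
have {}sh : 0 <= s <= h by move: sh; rewrite in_itv /= => /andP[? ?]; rewrite !ltW.
pose q t := 'D_u f (t *: v + (s *: u + x)).
pose dq t := 'D_v ('D_u f) (t *: v + (s *: u + x)).
have qd t : 0 <= t <= h -> is_derive t 1 q (dq t).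
  move=> th; apply: is_derive_line; have [d _] := dDf u; apply: d.
  by rewrite addrCA; exact: HA.
have [||t th] := @MVT R q dq 0 h h0.
- by move=> t; rewrite in_itv /= => /andP[t0 th]; apply: qd; rewrite !ltW.
- apply: continuous_in_subspaceT => t; rewrite inE /= in_itv /= => /qd pt.
  by apply/differentiable_continuous/derivable1_diffP.
rewrite /q subr0 scale0r add0r => E.
exists s, t; split => //.
  by move: th; rewrite in_itv /= => /andP[? ?]; rewrite !ltW.
by rewrite /dp addrCA E /dq addrCA.
Qed.

(** The second difference is symmetric in u and v, so on a small parallelogram it is h^2 times each
    of the mixed derivatives, at two different points. Continuity of both at x bounds their
    difference by any e. *)
Lemma derive_comm_real V (f : V -> R) (A : set V) (x u v : V) :
  open A -> Ck 2 A f -> A x -> 'D_u ('D_v f) x = 'D_v ('D_u f) x.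
Proof.
move=> oA Cf Ax; apply/eqP; rewrite -subr_eq0 -normr_le0; apply/ler_addgt0Pl => e e0.
rewrite addr0.
have Cuv : {for x, continuous ('D_u ('D_v f))} by case: Cf => _ /(_ v) [_ /(_ u)]; apply.
have Cvu : {for x, continuous ('D_v ('D_u f))} by case: Cf => _ /(_ u) [_ /(_ v)]; apply.
have e2 : 0 < e / 2 by rewrite divr_gt0.
have : \forall y \near x, [/\ A y, `|'D_u ('D_v f) x - 'D_u ('D_v f) y| < e / 2 &
    `|'D_v ('D_u f) x - 'D_v ('D_u f) y| < e / 2].
  have N1 : \forall y \near x, A y by exact: open_nbhs_nbhs.
  move/cvgrPdist_lt: Cuv => /(_ _ e2) N2.
  move/cvgrPdist_lt: Cvu => /(_ _ e2) N3.
  by apply: filterS3 N1 N2 N3 => y H1 H2 H3; exact: And3 H1 H2 H3.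
move=> /nbhs_ballP [r r0] rH.
(* With this h the parallelogram lies in the ball of radius r; the 1 keeps the denominator positive
   when u = v = 0. *)
pose h := r / (`|u| + `|v| + 1).
have k0 : 0 < `|u| + `|v| + 1 by rewrite ltr_wpDl ?addr_ge0.
have h0 : 0 < h by rewrite divr_gt0.
have B s t : 0 <= s <= h -> 0 <= t <= h -> ball x r (s *: u + (t *: v + x)).
  move=> /andP[s0 sh] /andP[t0 th]; rewrite -ball_normE /=.
  rewrite addrA opprD addrCA subrr addr0 normrN.
  apply: le_lt_trans (ler_normD _ _) _; rewrite !normrZ !ger0_norm //.
  apply: (@le_lt_trans _ _ (h * (`|u| + `|v|))).
    by rewrite mulrDr lerD // ler_wpM2r.
  by rewrite /h mulrAC -mulrA gtr_pMr // ltr_pdivrMr // mul1r ltrDl.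
have [|s [t [sh th E1]]] := @second_difference V f A x u v h h0 oA Cf.
  by move=> s t sh th; have [] := rH _ (B s t sh th).
have [|s' [t' [sh' th' E2]]] := @second_difference V f A x v u h h0 oA Cf.
  by move=> s' t' sh' th'; rewrite addrCA; have [] := rH _ (B t' s' th' sh').
have E : 'D_v ('D_u f) (s *: u + (t *: v + x)) = 'D_u ('D_v f) (t' *: u + (s' *: v + x)).
  have hn : h != 0 by rewrite gt_eqF.
  have cancel (a b : R) : a * h * h = b * h * h -> a = b by move/(mulIf hn)/(mulIf hn).
  (* Exchanging u and v swaps the two middle values of the second difference. *)
  have swap (a b c d : R) : a - b - (c - d) = a - c - (b - d) by ring.
  rewrite swap (addrCA (h *: v)) (addrCA (s' *: v)) in E2.
  exact: cancel (etrans (esym E1) E2).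
have [_ _ H1] := rH _ (B s t sh th); have [_ H2 _] := rH _ (B t' s' th' sh').
rewrite E in H1.
apply: (le_trans (ler_distD _ _ _)); rewrite (splitr e).
by apply: lerD; [exact/ltW/H2|rewrite distrC; exact/ltW/H1].
Qed.

(** The mean value theorem concerns real functions, so each coordinate is treated apart. *)
Lemma derive_comm V n (f : V -> 'rV[R]_n) (A : set V) (x u v : V) :
  open A -> Ck 2 A f -> A x -> 'D_u ('D_v f) x = 'D_v ('D_u f) x.
Proof.
move=> oA Cf Ax; apply/rowP => j.
have coord (g : V -> 'rV[R]_n) y w : differentiable g y ->
    'D_w g y 0 j = 'D_w (fun z => g z 0 j) y.
  by move=> dg; rewrite derive_mx ?mxE //; exact: diff_derivable.
have coord2 w w' : ('D_w ('D_w' f) x) 0 j = 'D_w ('D_w' (fun z => f z 0 j)) x.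
  case: (Cf) => df dDf.
  rewrite coord; last by have [d _] := dDf w'; exact: d.
  apply: near_eq_derive; near=> y; apply: coord; apply: df; near: y.
  exact: open_nbhs_nbhs.
have C := derive_comm_real u v oA (Ck_coord j oA Cf) Ax.
exact: (etrans (coord2 u v) (etrans C (esym (coord2 v u)))).
Unshelve. all: by end_near. Qed.

End Schwarz.

(** * Determinants and inverses of smooth families of matrices *)

Section CkMatrix.
Context {R : realType} {V : normedModType R}.

Lemma Ck_prod k (A : set V) I (r : seq I) (f : I -> V -> R) :
  open A -> (forall i, Ck k A (f i)) -> Ck k A (fun x => \prod_(i <- r) f i x).
Proof.
move=> oA Cf; elim: r => [|i r IH].
  by under eq_fun do rewrite big_nil; exact: Ck_cst.
by under eq_fun do rewrite big_cons; exact: (@Ck_scale _ _ R^o).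
Qed.

Lemma Ck_det k (A : set V) m (G : V -> 'M[R]_m) : open A ->
  (forall i j, Ck k A (fun x => G x i j)) -> Ck k A (fun x => \det (G x)).
Proof.
move=> oA CG; apply: (@Ck_sum _ _ R^o) => // s _.
apply: (@Ck_scale _ _ R^o) => //; first exact: Ck_cst.
by apply: Ck_prod => // i; exact: CG.
Qed.

(** Cramer's rule: an entry of the inverse is a cofactor divided by the determinant, and both are
    polynomial in the entries. *)
Lemma Ck_invmx k (A : set V) m (G : V -> 'M[R]_m) i j : open A ->
  (forall x, A x -> G x \in unitmx) ->
  (forall i j, Ck k A (fun x => G x i j)) -> Ck k A (fun x => invmx (G x) i j).
Proof.
move=> oA uG CG.
have H : Ck k A (fun x => (\det (G x))^-1 *:
    ((-1) ^+ (j + i) *: \det (row' j (col' i (G x))) : R^o)).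
  apply: (@Ck_scale _ _ R^o) => //.
    apply: CkV => //; last exact: Ck_det.
    by move=> x /uG; rewrite unitmxE unitfE.
  apply: (@Ck_scale _ _ R^o) => //; first exact: Ck_cst.
  by apply: Ck_det => // a b; under eq_fun do rewrite !mxE; exact: CG.
apply: eq_Ck H => // x; rewrite inE => /uG ux.
by rewrite /invmx ux !mxE.
Qed.

End CkMatrix.

(** * Functions and vector fields on a manifold *)

Section Manifold.
Context {R : realType} {n : nat} (M : smooth_manifold R n).
Implicit Types (W : normedModType R) (i j : chart_index M) (p q : M).
Implicit Types (U : set M).

Lemma near_chart i p (P : set M) : dom i p -> nbhs p P ->
  \forall y \near chart i p, P (chart_inv i y).
Proof.
move=> ip nP; apply: (chart_inv_continuous ip).
by rewrite /= chartK.
Qed.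

Lemma near_chart_inv i p : dom i p ->
  \forall y \near chart i p, dom i (chart_inv i y) /\ chart i (chart_inv i y) = y.
Proof.
move=> ip; have ni : nbhs (chart i p) (chart i @` dom i).
  by apply: open_nbhs_nbhs; split; [exact: chart_image_open|exists p].
by apply: filterS ni => _ [q iq <-]; rewrite chartK.
Qed.

(** By definition the images of whole chart domains are open; for a smaller open set, continuity of
    [chart_inv] keeps nearby coordinates over U. *)
Lemma open_chart_image i U : open U -> open (chart i @` (dom i `&` U)).
Proof.
move=> oU; rewrite openE => _ [p [ip Up] <-]; rewrite /interior.
have nU : nbhs p U by exact: open_nbhs_nbhs.
apply: filterS2 (near_chart_inv ip) (near_chart ip nU) => y [iy yE] Uy.
by exists (chart_inv i y).
Qed.

Lemma nbhs_dom i p : dom i p -> nbhs p (dom i).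
Proof. by move=> ip; apply: open_nbhs_nbhs; split=> //; exact: dom_open. Qed.

Lemma smooth_on_subset W U U' (f : M -> W) :
  U' `<=` U -> smooth_on U f -> smooth_on U' f.
Proof.
move=> UU sf i k; apply: Ck_subset (sf i k) => _ [p [ip Up] <-].
by exists p => //; split=> //; exact: UU.
Qed.

Lemma smooth_on_local W U (f : M -> W) :
  (forall p, U p -> exists2 U', U' p & smooth_on U' f) -> smooth_on U f.
Proof.
move=> H i k; apply: Ck_local => _ [p [ip /H[U' Up sf]] <-].
by exists (chart i @` (dom i `&` U')); [exists p|exact: sf].
Qed.

Lemma eq_smooth_on W U (f g : M -> W) : open U ->
  (forall p, U p -> f p = g p) -> smooth_on U f -> smooth_on U g.
Proof.
move=> oU fg sf i k; apply: eq_Ck (sf i k); first exact: open_chart_image.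
by move=> y; rewrite inE => -[p [ip Up] <-] /=; rewrite chartK // fg.
Qed.

Lemma smooth_on_cst W U (c : W) : smooth_on U (fun=> c).
Proof. by move=> i k; exact: Ck_cst. Qed.

Lemma smooth_onD W U (f g : M -> W) : open U -> smooth_on U f ->
  smooth_on U g -> smooth_on U (fun p => f p + g p).
Proof.
move=> oU sf sg i k.
exact: (CkD (open_chart_image oU) (sf i k) (sg i k)).
Qed.

Lemma smooth_on_scale W U (f : M -> R) (g : M -> W) : open U ->
  smooth_on U f -> smooth_on U g -> smooth_on U (fun p => f p *: g p).
Proof.
move=> oU sf sg i k.
exact: (Ck_scale (open_chart_image oU) (sf i k) (sg i k)).
Qed.

Lemma smooth_onM U (f g : M -> R) : open U ->
  smooth_on U f -> smooth_on U g -> smooth_on U (fun p => f p * g p).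
Proof. exact: (@smooth_on_scale R^o). Qed.

Lemma smooth_onN W U (f : M -> W) : open U -> smooth_on U f ->
  smooth_on U (fun p => - f p).
Proof.
move=> oU sf; under eq_fun do rewrite -scaleN1r.
by apply: smooth_on_scale => //; exact: smooth_on_cst.
Qed.

Lemma smooth_on_sum W U I (r : seq I) (f : I -> M -> W) : open U ->
  (forall a, smooth_on U (f a)) -> smooth_on U (fun p => \sum_(a <- r) f a p).
Proof.
move=> oU sf i k.
apply: (@Ck_sum _ _ _ _ _ _ _ _ (fun a => f a \o chart_inv i)).
  exact: open_chart_image.
by move=> a _; exact: sf.
Qed.

Lemma smooth_on_coord m U (f : M -> 'rV[R]_m) k : open U -> smooth_on U f ->
  smooth_on U (fun p => f p 0 k).
Proof.
by move=> oU sf i l; exact: (Ck_coord _ (open_chart_image oU) (sf i l)).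
Qed.

Lemma smooth_on_row m U (f : M -> 'rV[R]_m) : open U ->
  (forall k, smooth_on U (fun p => f p 0 k)) -> smooth_on U f.
Proof.
move=> oU sf i k.
apply: (@Ck_row _ _ _ _ _ (f \o chart_inv i)); first exact: open_chart_image.
by move=> j; exact: sf.
Qed.

Lemma smooth_on_invmx m U (G : M -> 'M[R]_m) a b : open U ->
  (forall p, U p -> G p \in unitmx) ->
  (forall c d, smooth_on U (fun p => G p c d)) ->
  smooth_on U (fun p => invmx (G p) a b).
Proof.
move=> oU uG sG i k.
apply: (@Ck_invmx _ _ _ _ _ (fun y => G (chart_inv i y))).
- exact: open_chart_image.
- by move=> _ [p [ip Up] <-]; rewrite chartK //; exact: uG.
- by move=> c d; exact: sG.
Qed.

(** Differentiability at one point, read in every chart around it: under this hypothesis [vder]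
    obeys the rules of calculus and may be computed in any chart. *)
Definition mdiff W p (f : M -> W) : Prop :=
  forall i, dom i p -> differentiable (f \o chart_inv i) (chart i p).

Lemma smooth_on_mdiff W U p (f : M -> W) : U p -> smooth_on U f -> mdiff p f.
Proof. by move=> Up sf i ip; have [df _] := sf i 1%N; apply: df; exists p. Qed.

Lemma smooth_on_chart i : smooth_on (dom i) (chart i).
Proof.
by move=> j k; rewrite setIC; have := @transition_smooth _ _ M j i k; rewrite setIC.
Qed.

Lemma mdiff_chart i p : dom i p -> mdiff p (chart i).
Proof. by move=> ip; exact: smooth_on_mdiff (smooth_on_chart i). Qed.

(** Independence of the chart: near p, f read in [chart_at p] is f read in i after the transition
    map, whose derivative along v is [comp i p v]. *)
Lemma vder_chart W i p v (f : M -> W) : dom i p -> mdiff p f ->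
  vder p v f = 'D_(comp i p v) (f \o chart_inv i) (chart i p).
Proof.
move=> ip df; rewrite /comp /vder; set c := chart_at p.
have cp : dom c p := mem_chart_at p.
have pE : (chart i \o chart_inv c) (chart c p) = chart i p by rewrite /= chartK.
rewrite -(derive_comp v (mdiff_chart ip cp) pE (df i ip)).
apply: near_eq_derive.
apply: filterS (near_chart cp (nbhs_dom ip)) => y iy /=.
by rewrite chartK.
Qed.

Lemma near_eq_vder W p v (f g : M -> W) :
  (\forall q \near p, f q = g q) -> vder p v f = vder p v g.
Proof.
move=> fg; apply: near_eq_derive.
exact: (near_chart (mem_chart_at p) fg).
Qed.

Lemma near_eq_mdiff W p (f g : M -> W) :
  (\forall q \near p, f q = g q) -> mdiff p f -> mdiff p g.
Proof.
move=> fg df i ip; apply: near_eq_differentiable (df i ip).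
exact: (near_chart ip fg).
Qed.

Lemma vder_cst W p v (c : W) : vder p v (fun=> c) = 0.
Proof. exact: derive_cst. Qed.

Lemma mdiff_cst W p (c : W) : mdiff p (fun=> c).
Proof. by move=> i ip; exact: differentiable_cst. Qed.

Lemma mdiffD W p (f g : M -> W) : mdiff p f -> mdiff p g ->
  mdiff p (fun q => f q + g q).
Proof.
move=> df dg i ip.
exact: (differentiableD (df _ ip) (dg _ ip)).
Qed.

Lemma vderD W p v (f g : M -> W) : mdiff p f -> mdiff p g ->
  vder p v (fun q => f q + g q) = vder p v f + vder p v g.
Proof.
move=> /(_ _ (mem_chart_at p)) df /(_ _ (mem_chart_at p)) dg.
exact: (deriveD (diff_derivable (v := v) df) (diff_derivable dg)).
Qed.

Lemma mdiff_scale W p (f : M -> R) (g : M -> W) : mdiff p f -> mdiff p g ->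
  mdiff p (fun q => f q *: g q).
Proof.
move=> df dg i ip.
exact: (differentiable_scale (df _ ip) (dg _ ip)).
Qed.

Lemma vder_scale W p v (f : M -> R) (g : M -> W) : mdiff p f -> mdiff p g ->
  vder p v (fun q => f q *: g q) = vder p v f *: g p + f p *: vder p v g.
Proof.
move=> /(_ _ (mem_chart_at p)) df /(_ _ (mem_chart_at p)) dg.
have := derive_scale v df dg.
by rewrite [X in _ = X -> _]/= chartK //; exact: mem_chart_at.
Qed.

Lemma mdiff_sum W p I (r : seq I) (f : I -> M -> W) :
  (forall a, mdiff p (f a)) -> mdiff p (fun q => \sum_(a <- r) f a q).
Proof.
move=> df; elim: r => [|a r IH].
  by under eq_fun do rewrite big_nil; exact: mdiff_cst.
by under eq_fun do rewrite big_cons; exact: mdiffD.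
Qed.

Lemma vder_sum W p v I (r : seq I) (f : I -> M -> W) :
  (forall a, mdiff p (f a)) ->
  vder p v (fun q => \sum_(a <- r) f a q) = \sum_(a <- r) vder p v (f a).
Proof.
move=> df; elim: r => [|a r IH].
  by under eq_fun do rewrite big_nil; rewrite vder_cst big_nil.
under eq_fun do rewrite big_cons.
by rewrite vderD ?IH ?big_cons //; exact: mdiff_sum.
Qed.

Lemma mdiff_coord m p (f : M -> 'rV[R]_m) k : mdiff p f ->
  mdiff p (fun q => f q 0 k).
Proof.
move=> df i ip; exact: (@differentiable_comp _ _ _ _ (f \o chart_inv i)
  (fun w : 'rV[R]_m => w 0 k) _ (df _ ip) (differentiable_coord _ _ _)).
Qed.

Lemma vder_coord m p v (f : M -> 'rV[R]_m) k : mdiff p f ->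
  vder p v (fun q => f q 0 k) = (vder p v f) 0 k.
Proof.
move=> /(_ _ (mem_chart_at p)) df.
by rewrite /vder [in RHS]derive_mx ?mxE //; exact: diff_derivable.
Qed.

Lemma vder_linear W p (f : M -> W) : mdiff p f -> linear (fun v => vder p v f).
Proof. by move=> df; apply: derive_linear; exact/df/mem_chart_at. Qed.

Lemma vder_row W p v (f : M -> W) : mdiff p f ->
  vder p v f = \sum_k v 0 k *: vder p 'e_k f.
Proof. by move=> df; apply: derive_row; exact/df/mem_chart_at. Qed.

(** * Components in a chart and coordinate fields *)

Lemma comp_linear i p : dom i p -> linear (comp i p).
Proof. by move=> ip; apply: vder_linear; exact: mdiff_chart. Qed.

Lemma comp_sum i p I (r : seq I) (a : I -> R) (v : I -> 'rV[R]_n) : dom i p ->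
  comp i p (\sum_(k <- r) a k *: v k) = \sum_(k <- r) a k *: comp i p (v k).
Proof.
move=> ip; pose L : {linear 'rV[R]_n -> 'rV[R]_n} :=
  HB.pack (comp i p) (GRing.isLinear.Build _ _ _ _ _ (comp_linear ip)).
rewrite -[comp i p]/(L : _ -> _) linear_sum.
by apply: eq_bigr => k _; rewrite linearZ.
Qed.

Lemma comp_chart_at p v : comp (chart_at p) p v = v.
Proof.
have cp := mem_chart_at p.
rewrite /comp /vder -[RHS](derive_id (chart (chart_at p) p) v).
apply: near_eq_derive.
by apply: filterS (near_chart_inv cp) => y [].
Qed.

Lemma comp_transition i j p v : dom i p -> dom j p ->
  comp j p v = 'D_(comp i p v) (chart j \o chart_inv i) (chart i p).
Proof. by move=> ip jp; apply: vder_chart => //; exact: mdiff_chart. Qed.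

(** In [chart_at p] a vector is its own components, so v is the derivative of the transition map
    from i along [comp i p v]; the sum expands this derivative over the basis. *)
Lemma coord_vf_expand i p v : dom i p ->
  v = \sum_k (comp i p v) 0 k *: coord_vf i k p.
Proof.
move=> ip; have cp := mem_chart_at p.
rewrite -[LHS](comp_chart_at p) (comp_transition v ip cp) derive_row //.
exact: mdiff_chart.
Qed.

Lemma comp_coord_vf i j p k : dom i p -> dom j p ->
  comp j p (coord_vf i k p) = 'D_'e_k (chart j \o chart_inv i) (chart i p).
Proof.
move=> ip jp; have cp := mem_chart_at p.
rewrite (comp_transition _ cp jp) comp_chart_at /coord_vf.
set c := chart_at p.
have pE : (chart c \o chart_inv i) (chart i p) = chart c p by rewrite /= chartK.
rewrite -(derive_comp 'e_k (mdiff_chart cp ip) pE (mdiff_chart jp cp)).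
apply: near_eq_derive.
apply: filterS (near_chart ip (nbhs_dom cp)) => y cy /=.
by rewrite chartK.
Qed.

Lemma comp_coord_vf_diag i p k : dom i p -> comp i p (coord_vf i k p) = 'e_k.
Proof.
move=> ip; rewrite comp_coord_vf // -[RHS](derive_id (chart i p)).
apply: near_eq_derive.
by apply: filterS (near_chart_inv ip) => y [].
Qed.

Lemma coord_vf_chart_at p k : coord_vf (chart_at p) k p = 'e_k.
Proof.
by rewrite -[LHS](comp_chart_at p) comp_coord_vf_diag //; exact: mem_chart_at.
Qed.

Lemma smooth_on_in_chart W U i (h : 'rV[R]_n -> W) : open U ->
  Cinfty (chart i @` (dom i `&` U)) h -> smooth_on (dom i `&` U) (h \o chart i).
Proof.
move=> oU Ch j k.
have oiU : open (dom i `&` U) by apply: openI => //; exact: dom_open.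
apply: (@Ck_comp _ _ _ _ _ _ _ (chart i \o chart_inv j) h
  (open_chart_image oiU) _ _ (Ch k)).
- by move=> _ [p [jp iUp] <-] /=; rewrite chartK //; exists p.
- apply: Ck_subset (@transition_smooth _ _ M j i k) => _ [p [jp [ip _]] <-].
  by exists p.
Qed.

Lemma smooth_vf_subset U U' (X : M -> 'rV[R]_n) :
  U' `<=` U -> smooth_vf U X -> smooth_vf U' X.
Proof.
move=> UU sX i; apply: smooth_on_subset (sX i) => p [ip Up].
by split=> //; exact: UU.
Qed.

Lemma smooth_vf_coord i k : smooth_vf (dom i) (@coord_vf R n M i k).
Proof.
move=> j.
have H : smooth_on (dom i `&` dom j) ('D_'e_k (chart j \o chart_inv i) \o chart i).
  apply: smooth_on_in_chart; first exact: dom_open.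
  by move=> l; have [_ d] := @transition_smooth _ _ M i j l.+1; exact: d.
rewrite setIC; apply: eq_smooth_on H; first by apply: openI; exact: dom_open.
by move=> p [ip jp] /=; rewrite comp_coord_vf.
Qed.

Lemma smooth_vfD U (X Y : M -> 'rV[R]_n) : open U ->
  smooth_vf U X -> smooth_vf U Y -> smooth_vf U (fun p => X p + Y p).
Proof.
move=> oU sX sY i.
have oiU : open (dom i `&` U) by apply: openI => //; exact: dom_open.
apply: (eq_smooth_on oiU _ (smooth_onD oiU (sX i) (sY i))) => p [ip _].
by have := comp_linear ip 1 (X p) (Y p); rewrite !scale1r.
Qed.

Lemma smooth_vf_scale U (f : M -> R) (X : M -> 'rV[R]_n) : open U ->
  smooth_on U f -> smooth_vf U X -> smooth_vf U (fun p => f p *: X p).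
Proof.
move=> oU sf sX i.
have oiU : open (dom i `&` U) by apply: openI => //; exact: dom_open.
have sf' : smooth_on (dom i `&` U) f by apply: smooth_on_subset sf => p [].
apply: (eq_smooth_on oiU _ (smooth_on_scale oiU sf' (sX i))) => p [ip _].
pose L : {linear 'rV[R]_n -> 'rV[R]_n} :=
  HB.pack (comp i p) (GRing.isLinear.Build _ _ _ _ _ (comp_linear ip)).
by rewrite -[comp i p]/(L : _ -> _) linearZ.
Qed.

Lemma smooth_on_vder W U (f : M -> W) (X : M -> 'rV[R]_n) : open U ->
  smooth_on U f -> smooth_vf U X -> smooth_on U (fun p => vder p (X p) f).
Proof.
move=> oU sf sX i k.
have oA := open_chart_image oU.
(* In the chart, X f is the sum of the X^l d_l f; one order of smoothness of f is spent. *)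
have H : Ck k (chart i @` (dom i `&` U)) (fun y =>
    \sum_l (comp i (chart_inv i y) (X (chart_inv i y))) 0 l *:
      'D_'e_l (f \o chart_inv i) y).
  apply: Ck_sum => // l _; apply: Ck_scale => //.
    apply: Ck_coord => //.
    by have := sX i i k; rewrite setIA setIid.
  by have [_ d] := sf i k.+1; exact: d.
apply: eq_Ck H => // y; rewrite inE => -[p [ip Up] <-] /=; rewrite chartK //.
have df := smooth_on_mdiff Up sf.
by rewrite (vder_chart _ ip df) derive_row //; exact: df.
Qed.

End Manifold.

(** * Sums under linear maps and symmetric double sums *)

Lemma linear_sumZ (R : pzRingType) (V W : lmodType R) (f : V -> W) (fl : linear f)
    I (r : seq I) (a : I -> R) (v : I -> V) :
  f (\sum_(k <- r) a k *: v k) = \sum_(k <- r) a k *: f (v k).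
Proof.
pose L : {linear V -> W} := HB.pack f (GRing.isLinear.Build _ _ _ _ _ fl).
rewrite -[f]/(L : _ -> _) linear_sum.
by apply: eq_bigr => k _; rewrite linearZ.
Qed.

Lemma linear_subE (R : pzRingType) (V W : lmodType R) (f : V -> W) (fl : linear f) u v :
  f (u - v) = f u - f v.
Proof. by rewrite addrC -scaleN1r fl scaleN1r addrC. Qed.

Lemma linear_scaleE (R : pzRingType) (V W : lmodType R) (f : V -> W) (fl : linear f) a v :
  f (a *: v) = a *: f v.
Proof.
by have := linear_sumZ fl [:: tt] (fun=> a) (fun=> v); rewrite !big_seq1.
Qed.

(** Serves to cancel second-order terms: symmetric second derivatives in the Lie bracket, symmetric
    Christoffel terms in the torsion. *)
Lemma sum_sym_swap (R : comPzRingType) (V : lmodType R) m (S : 'I_m -> 'I_m -> V) :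
  (forall a b, S a b = S b a) -> forall x y : 'I_m -> R,
  \sum_a \sum_b (x a * y b) *: S a b = \sum_a \sum_b (y a * x b) *: S a b.
Proof.
move=> symS x y; rewrite exchange_big; apply: eq_bigr => a _.
by apply: eq_bigr => b _; rewrite mulrC symS.
Qed.

(** * The Lie bracket as a commutator of derivations *)

Section LieBracket.
Context {R : realType} {m : nat} (M : smooth_manifold R m).
Implicit Types (p q : M) (U : set M).

Lemma mdiff_vf U p i (X : M -> 'rV[R]_m) : U p -> dom i p -> smooth_vf U X ->
  mdiff p (fun q => comp i q (X q)).
Proof. by move=> Up ip sX; exact: (smooth_on_mdiff (conj ip Up) (sX i)). Qed.

(** In the chart i the coordinate fields act near p as partial derivatives, so this is
    [derive_comm]. *)
Lemma vder_coord_comm n U p (f : M -> 'rV[R]_n) i (a b : 'I_m) :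
  open U -> U p -> dom i p -> smooth_on U f ->
  vder p (coord_vf i b p) (fun q => vder q (coord_vf i a q) f) =
  vder p (coord_vf i a p) (fun q => vder q (coord_vf i b q) f).
Proof.
move=> oU Up ip sf; pose A := chart i @` (dom i `&` U).
have E k k' : vder p (coord_vf i k p) (fun q => vder q (coord_vf i k' q) f) =
    'D_'e_k ('D_'e_k' (f \o chart_inv i)) (chart i p).
  have sk : smooth_on (U `&` dom i) (fun q => vder q (coord_vf i k' q) f).
    apply: smooth_on_vder; first by apply: openI => //; exact: dom_open.
      by apply: smooth_on_subset sf => q [].
    by apply: smooth_vf_subset (smooth_vf_coord i k') => q [].
  rewrite (vder_chart _ ip (smooth_on_mdiff (conj Up ip) sk)) (comp_coord_vf_diag _ ip).
  apply: near_eq_derive.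
  have nU : nbhs p U by exact: open_nbhs_nbhs.
  apply: filterS2 (near_chart_inv ip) (near_chart ip nU) => y [iy yE] Uy /=.
  have df := smooth_on_mdiff Uy sf.
  by rewrite (vder_chart _ iy df) (comp_coord_vf_diag _ iy) yE.
apply: (etrans (E _ _)); apply: (etrans _ (esym (E _ _))).
apply: (@derive_comm _ _ _ _ A _ _ _ (open_chart_image oU) (sf i 2%N)).
by exists p.
Qed.

(** Near p, Y is a combination of coordinate fields. The product rule separates the derivative of
    its components from the second derivatives of f, where v and Y enter through their values at
    p. *)
Lemma vder_vder n U p v (f : M -> 'rV[R]_n) (Y : M -> 'rV[R]_m) :
  open U -> U p -> smooth_on U f -> smooth_vf U Y ->
  let i := chart_at p in
  vder p v (fun q => vder q (Y q) f) =
  vder p (vder p v (fun q => comp i q (Y q))) f +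
  \sum_a \sum_b ((comp i p (Y p)) 0 a * (comp i p v) 0 b) *:
    vder p (coord_vf i b p) (fun q => vder q (coord_vf i a q) f).
Proof.
move=> oU Up sf sY i; have ip : dom i p := mem_chart_at p.
have df := smooth_on_mdiff Up sf; have dY := mdiff_vf Up ip sY.
have nU : nbhs p U by exact: open_nbhs_nbhs.
have dk a : mdiff p (fun q => vder q (coord_vf i a q) f).
  have sk : smooth_on (U `&` dom i) (fun q => vder q (coord_vf i a q) f).
    apply: smooth_on_vder; first by apply: openI => //; exact: dom_open.
      by apply: smooth_on_subset sf => q [].
    by apply: smooth_vf_subset (smooth_vf_coord i a) => q [].
  exact: smooth_on_mdiff (conj Up ip) sk.
have near_expand : \forall q \near p, vder q (Y q) f =
    \sum_a (comp i q (Y q)) 0 a *: vder q (coord_vf i a q) f.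
  apply: filterS2 nU (nbhs_dom ip) => q Uq iq.
  rewrite {1}(coord_vf_expand (Y q) iq).
  exact: (linear_sumZ (vder_linear (smooth_on_mdiff Uq sf))).
rewrite (near_eq_vder v near_expand) vder_sum; last first.
  by move=> a; apply: mdiff_scale; [exact: mdiff_coord|exact: dk].
rewrite (vder_row _ df) -big_split /=.
apply: eq_bigr => a _; rewrite vder_scale; [|exact: mdiff_coord|exact: dk].
rewrite (vder_coord _ _ dY) coord_vf_chart_at; congr (_ + _).
rewrite {1}(coord_vf_expand v ip) (linear_sumZ (vder_linear (dk a))) scaler_sumr.
by apply: eq_bigr => b _; rewrite scalerA.
Qed.

(** The second-order parts of the two expansions coincide by symmetry; the first-order parts are the
    two halves of [lie_bracket], defined with the same chart [chart_at p]. *)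
Lemma vder_lie_bracket n U p (f : M -> 'rV[R]_n) (X Y : M -> 'rV[R]_m) :
  open U -> U p -> smooth_on U f -> smooth_vf U X -> smooth_vf U Y ->
  vder p (X p) (fun q => vder q (Y q) f) - vder p (Y p) (fun q => vder q (X q) f) =
  vder p (lie_bracket X Y p) f.
Proof.
move=> oU Up sf sX sY; set c := chart_at p; have cp : dom c p := mem_chart_at p.
have df := smooth_on_mdiff Up sf.
have comm a b := vder_coord_comm b a oU Up cp sf.
rewrite (vder_vder (X p) oU Up sf sY) (vder_vder (Y p) oU Up sf sX).
have cancel (a b d e : 'rV[R]_n) : e = b -> a + b - (d + e) = a - d.
  by move=> ->; rewrite opprD addrACA subrr addr0.
pose S a b := vder p (coord_vf c b p) (fun q => vder q (coord_vf c a q) f).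
rewrite (cancel _ _ _ _ (@sum_sym_swap _ _ _ S (fun a b => comm b a) _ _)).
exact: (esym (linear_subE (vder_linear df) _ _)).
Qed.

End LieBracket.

(** * Smooth maps and the pull-back bundle *)

Section SmoothMap.
Context {R : realType} {n m : nat} (N : smooth_manifold R n)
  (M : smooth_manifold R m) (F : M -> N) (smF : smooth_map F).
Implicit Types (W : normedModType R) (p q : M) (j : chart_index N).

Lemma open_preimage_map (V : set N) : open V -> open (F @^-1` V).
Proof. by case: smF => cF _; apply: open_comp => x _; exact: cF. Qed.

Lemma nbhs_preimage_dom j p : dom j (F p) -> nbhs p (F @^-1` dom j).
Proof.
by move=> jp; apply: open_nbhs_nbhs; split=> //; exact/open_preimage_map/dom_open.
Qed.

Lemma mdiff_chart_map j p : dom j (F p) -> mdiff p (chart j \o F).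
Proof.
move=> jp; case: smF => _ /(_ j) sj.
exact: (@smooth_on_mdiff _ _ _ _ (F @^-1` dom j) _ _ jp sj).
Qed.

Lemma near_map_chart W i p (h : N -> W) : dom i p ->
  \forall y \near chart i p,
    ((h \o chart_inv (chart_at (F p))) \o
      ((chart (chart_at (F p)) \o F) \o chart_inv i)) y = ((h \o F) \o chart_inv i) y.
Proof.
move=> ip; have jp := mem_chart_at (F p).
apply: filterS (near_chart ip (nbhs_preimage_dom jp)) => y jy /=.
by rewrite chartK.
Qed.

Lemma mdiff_map W p (h : N -> W) : mdiff (F p) h -> mdiff p (h \o F).
Proof.
move=> dh i ip; have jp := mem_chart_at (F p).
apply: near_eq_differentiable (near_map_chart h ip) _.
apply: differentiable_comp; first exact: mdiff_chart_map.
by rewrite /= chartK //; exact: dh.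
Qed.

Lemma vder_map W p v (h : N -> W) : mdiff (F p) h ->
  vder p v (h \o F) = vder (F p) (tangent_map F p v) h.
Proof.
move=> dh; have jp := mem_chart_at (F p); have cp := mem_chart_at p.
rewrite {1}/vder -(near_eq_derive _ (near_map_chart h cp)) /vder /tangent_map.
apply: derive_comp; first exact: mdiff_chart_map.
  by rewrite /= chartK.
exact: dh.
Qed.

Lemma smooth_on_map W (V : set N) (h : N -> W) : open V -> smooth_on V h ->
  smooth_on (F @^-1` V) (h \o F).
Proof.
move=> oV sh i k; apply: Ck_local => _ [p [ip Vp] <-].
set j := chart_at (F p); have jp : dom j (F p) := mem_chart_at (F p).
have oU : open (F @^-1` (dom j `&` V)).
  by apply: open_preimage_map; apply: openI => //; exact: dom_open.
exists (chart i @` (dom i `&` (F @^-1` (dom j `&` V)))); first by exists p.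
have [_ sF] := smF.
have H : Ck k (chart i @` (dom i `&` (F @^-1` (dom j `&` V))))
    ((h \o chart_inv j) \o ((chart j \o F) \o chart_inv i)).
  apply: Ck_comp (open_chart_image oU) _ _ (sh j k).
    move=> _ [q [iq [jq Vq]] <-] /=; rewrite chartK //.
    by exists (F q).
  by apply: Ck_subset (sF j i k) => _ [q [iq [jq _]] <-]; exists q.
apply: eq_Ck H; first exact: open_chart_image.
by move=> y; rewrite inE => -[q [iq [jq Vq]] <-] /=; rewrite !chartK.
Qed.

Lemma tangent_map_linear p : linear (tangent_map F p).
Proof. by apply: vder_linear; apply: mdiff_chart_map; exact: mem_chart_at. Qed.

Lemma comp_tangent_map j p v : dom j (F p) ->
  comp j (F p) (tangent_map F p v) = vder p v (chart j \o F).
Proof. by move=> jp; rewrite (vder_map _ (mdiff_chart jp)). Qed.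

(* Smoothness on U of a section of the pull-back bundle F^*TN. *)
Definition smooth_along (U : set M) (V : M -> 'rV[R]_n) : Prop :=
  forall j, smooth_on (U `&` F @^-1` dom j) (fun q => comp j (F q) (V q)).

Lemma open_along (U : set M) j : open U -> open (U `&` F @^-1` dom j).
Proof. by move=> oU; apply: openI => //; exact/open_preimage_map/dom_open. Qed.

Lemma smooth_along_mdiff (U : set M) V j p : U p -> dom j (F p) ->
  smooth_along U V -> mdiff p (fun q => comp j (F q) (V q)).
Proof.
move=> Up jp sV.
exact: (@smooth_on_mdiff _ _ _ _ (U `&` F @^-1` dom j) _ _ (conj Up jp) (sV j)).
Qed.

Lemma smooth_along_map (Y : N -> 'rV[R]_n) : smooth_vf setT Y ->
  smooth_along setT (Y \o F).
Proof.
move=> sY j; have sj := sY j; rewrite setIT in sj; rewrite setTI.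
exact: smooth_on_map (dom_open j) sj.
Qed.

(** The components of dF(X) in the chart j are the derivatives of chart j \o F along X. *)
Lemma smooth_along_push (U : set M) (X : M -> 'rV[R]_m) : open U ->
  smooth_vf U X -> smooth_along U (push F X).
Proof.
move=> oU sX j; have oj := open_along j oU; have [_ /(_ j) sj] := smF.
apply: (eq_smooth_on oj _ (smooth_on_vder oj _ _)).
- by move=> q [_ jq]; rewrite comp_tangent_map.
- by apply: smooth_on_subset sj => q [].
- by apply: smooth_vf_subset sX => q [].
Qed.

Lemma smooth_alongD (U : set M) V V' : open U -> smooth_along U V ->
  smooth_along U V' -> smooth_along U (fun q => V q + V' q).
Proof.
move=> oU sV sV' j; have oj := open_along j oU.
apply: (eq_smooth_on oj _ (smooth_onD oj (sV j) (sV' j))) => q [_ jq].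
by have := comp_linear jq 1 (V q) (V' q); rewrite !scale1r.
Qed.

Lemma smooth_along_scale (U : set M) (f : M -> R) V : open U ->
  smooth_on U f -> smooth_along U V -> smooth_along U (fun q => f q *: V q).
Proof.
move=> oU sf sV j; have oj := open_along j oU.
have sf' : smooth_on (U `&` F @^-1` dom j) f.
  by apply: smooth_on_subset sf => q [].
apply: (eq_smooth_on oj _ (smooth_on_scale oj sf' (sV j))) => q [_ jq].
by rewrite (linear_scaleE (comp_linear jq)).
Qed.

(** [tensor02] speaks of fields on N, whereas V and V' live along F. After expansion in coordinate
    fields, g is evaluated on fields of N and the result is composed with F. *)
Lemma smooth_on_tensor02 (U : set M) (g : N -> 'rV[R]_n -> 'rV[R]_n -> R) V V' :
  open U -> tensor02 g -> smooth_along U V -> smooth_along U V' ->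
  smooth_on U (fun q => g (F q) (V q) (V' q)).
Proof.
move=> oU [gr [gl sg]] sV sV'; apply: smooth_on_local => p Up.
set j := chart_at (F p); have jp : dom j (F p) := mem_chart_at (F p).
have oj := open_along j oU.
exists (U `&` F @^-1` dom j) => //.
have H : smooth_on (U `&` F @^-1` dom j) (fun q => \sum_k
    (comp j (F q) (V q)) 0 k *: \sum_l (comp j (F q) (V' q)) 0 l *:
    (g (F q) (coord_vf j k (F q)) (coord_vf j l (F q)) : R^o)).
  apply: smooth_on_sum => // k; apply: (smooth_on_scale oj).
    exact: (smooth_on_coord k oj (sV j)).
  apply: smooth_on_sum => // l; apply: (smooth_on_scale oj).
    exact: (smooth_on_coord l oj (sV' j)).
  have sgkl := sg _ _ _ (dom_open j) (smooth_vf_coord j k) (smooth_vf_coord j l).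
  have sgF := smooth_on_map (dom_open j) sgkl.
  by apply: smooth_on_subset sgF => q [].
apply: eq_smooth_on H => // q [_ jq].
rewrite [in RHS](coord_vf_expand (V q) jq) (linear_sumZ (gl _ _)).
apply: eq_bigr => k _; congr (_ *: _).
by rewrite [in RHS](coord_vf_expand (V' q) jq) (linear_sumZ (gr _ _)).
Qed.

End SmoothMap.

(** * Connections and their pull-backs *)

Section Connection.
Context {R : realType} {n : nat} (N : smooth_manifold R n) (D : connection N)
  (affD : affine_connection D).
Implicit Types (p : N) (U : set N).

Lemma smooth_vf0 U : smooth_vf U (fun _ : N => 0 : 'rV[R]_n).
Proof.
move=> i; have oi := dom_open i.
have s0 : smooth_on (dom i) (fun q : N => comp i q 0).
  apply: eq_smooth_on oi _ (smooth_on_cst (dom i) (0 : 'rV[R]_n)) => q iq.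
  by have := linear_subE (comp_linear iq) 0 0; rewrite !subrr.
by apply: smooth_on_subset s0 => q [].
Qed.

Lemma smooth_vf_sum U I (r : seq I) (Y : I -> N -> 'rV[R]_n) : open U ->
  (forall k, smooth_vf U (Y k)) -> smooth_vf U (fun q => \sum_(k <- r) Y k q).
Proof.
move=> oU sY; elim: r => [|k r IH].
  by under eq_fun do rewrite big_nil; exact: smooth_vf0.
by under eq_fun do rewrite big_cons; exact: smooth_vfD oU (sY k) IH.
Qed.

Lemma connection_sum U p v I (r : seq I) (f : I -> N -> R) (Y : I -> N -> 'rV[R]_n) :
  open U -> U p -> (forall k, smooth_on U (f k)) -> (forall k, smooth_vf U (Y k)) ->
  D p v (fun q => \sum_(k <- r) f k q *: Y k q) =
  \sum_(k <- r) (vder p v (f k) *: Y k p + f k p *: D p v (Y k)).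
Proof.
case: affD => _ addD leibD _ oU Up sf sY.
have sfY k := smooth_vf_scale oU (sf k) (sY k).
elim: r => [|k r IH].
  under eq_fun do rewrite big_nil; rewrite big_nil.
  (* D p v 0 = 0 follows from additivity at 0 + 0. *)
  have := addD U p v _ _ oU Up (smooth_vf0 U) (smooth_vf0 U).
  under eq_fun do rewrite addr0.
  by move/eqP; rewrite -subr_eq0 opprD addrA subrr sub0r oppr_eq0 => /eqP.
under eq_fun do rewrite big_cons; rewrite big_cons -IH.
rewrite (addD U p v _ _ oU Up (sfY k) (smooth_vf_sum r oU sfY)); congr (_ + _).
exact: (leibD U p v _ _ oU Up (sf k) (sY k)).
Qed.

(* The axioms only ask for smoothness on U, so the indicator function of U can
   play the part of a bump function. *)
Lemma connection_local U p v (Y Z : N -> 'rV[R]_n) : open U -> U p ->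
  smooth_vf U Y -> smooth_vf U Z -> (forall q, U q -> Y q = Z q) ->
  D p v Y = D p v Z.
Proof.
case: affD => _ _ leibD _ oU Up sY sZ YZ.
pose f q : R := if `[< U q >] then 1 else 0.
have fU q : U q -> f q = 1 by move=> Uq; rewrite /f asboolT.
have sf : smooth_on U f.
  by apply: eq_smooth_on oU _ (smooth_on_cst U (1 : R)) => q Uq; rewrite fU.
have vf : vder p v f = 0.
  rewrite -(vder_cst p v (1 : R)); apply: near_eq_vder.
  apply: filterS (open_nbhs_nbhs (conj oU Up)) => q; exact: fU.
have E W : smooth_vf U W -> D p v (fun q => f q *: W q) = D p v W.
  by move=> sW; rewrite (leibD U p v f W oU Up sf sW) vf fU // scale0r add0r scale1r.
rewrite -(E Y sY) -(E Z sZ); congr (D p v _); apply/funext => q.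
by rewrite /f; case: asboolP => [/YZ ->|_] //; rewrite !scale0r.
Qed.

End Connection.

Section PullbackDerivative.
Context {R : realType} {n m : nat} (N : smooth_manifold R n)
  (M : smooth_manifold R m) (F : M -> N) (smF : smooth_map F)
  (D : connection N) (affD : affine_connection D).
Implicit Types (p q : M) (j : chart_index N) (V : M -> 'rV[R]_n).

Local Notation PD := (pullback_derivative F D).
Local Notation dF := (tangent_map F).

Lemma vder_map_comp U p v (Y : N -> 'rV[R]_n) j : U (F p) -> dom j (F p) ->
  smooth_vf U Y ->
  vder p v (fun q => comp j (F q) (Y (F q))) =
  vder (F p) (dF p v) (fun q : N => comp j q (Y q)).
Proof.
move=> Up jp sY.
exact: (vder_map smF v (mdiff_vf (U := U) (p := F p) Up jp sY)).
Qed.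

(** Locality and the Leibniz rule for Y = sum Y^k d_k give the two terms of [pullback_derivative],
    since the derivative of Y^k along dF v is that of Y^k \o F along v. *)
Lemma pullback_derivative_map U p v (Y : N -> 'rV[R]_n) : open U -> U (F p) ->
  smooth_vf U Y -> PD p v (Y \o F) = D (F p) (dF p v) Y.
Proof.
move=> oU Up sY; rewrite /pullback_derivative; set j := chart_at (F p).
have jp : dom j (F p) := mem_chart_at (F p).
have oUj : open (U `&` dom j) by apply: openI => //; exact: dom_open.
have sYj : smooth_vf (U `&` dom j) Y by apply: smooth_vf_subset sY => q [].
have sc k : smooth_vf (U `&` dom j) (@coord_vf R n N j k).
  by apply: smooth_vf_subset (smooth_vf_coord j k) => q [].
have sYk k : smooth_on (U `&` dom j) (fun q : N => (comp j q (Y q)) 0 k).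
  by apply: smooth_on_coord => //; rewrite setIC; exact: (sY j).
have E : D (F p) (dF p v) Y =
    D (F p) (dF p v) (fun q : N => \sum_k (comp j q (Y q)) 0 k *: coord_vf j k q).
  apply: (connection_local affD _ oUj (conj Up jp) sYj).
    exact: (smooth_vf_sum _ oUj (fun k => smooth_vf_scale oUj (sYk k) (sc k))).
  by move=> q [Uq jq]; exact: coord_vf_expand.
rewrite E (connection_sum affD _ _ oUj (conj Up jp) sYk sc) big_split /=.
rewrite (vder_map_comp v Up jp sY); congr (_ + _).
  rewrite [LHS]row_sum_delta; apply: eq_bigr => k _.
  by rewrite coord_vf_chart_at (vder_coord _ _ (mdiff_vf (U := U) (p := F p) Up jp sY)).
by apply: eq_bigr => k _; rewrite comp_chart_at.
Qed.

Lemma near_eq_pullback_derivative p v V V' :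
  (\forall q \near p, V q = V' q) -> PD p v V = PD p v V'.
Proof.
move=> VV; have E : \forall q \near p,
    comp (chart_at (F p)) (F q) (V q) = comp (chart_at (F p)) (F q) (V' q).
  by apply: filterS VV => q ->.
by rewrite /pullback_derivative (near_eq_vder v E) (nbhs_singleton VV).
Qed.

(** One chart suffices: [pullback_derivative] at p reads components in [chart_at (F p)]. *)
Definition mdiff_along p V : Prop :=
  mdiff p (fun q => comp (chart_at (F p)) (F q) (V q)).

Lemma near_comp_lin p (f : M -> R) V V' :
  let j := chart_at (F p) in \forall q \near p,
  f q *: comp j (F q) (V q) + comp j (F q) (V' q) =
    comp j (F q) (f q *: V q + V' q).
Proof.
move=> j; apply: filterS (nbhs_preimage_dom smF (mem_chart_at (F p))) => q jq.
by rewrite (comp_linear jq (f q)).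
Qed.

Lemma mdiff_along_lin p (f : M -> R) V V' : mdiff p f ->
  mdiff_along p V -> mdiff_along p V' -> mdiff_along p (fun q => f q *: V q + V' q).
Proof.
move=> df dV dV'; apply: near_eq_mdiff (near_comp_lin p f V V') _.
exact: (mdiffD (mdiff_scale df dV) dV').
Qed.

Lemma pullback_derivative_lin p v (f : M -> R) V V' : mdiff p f ->
  mdiff_along p V -> mdiff_along p V' ->
  PD p v (fun q => f q *: V q + V' q) =
  vder p v f *: V p + f p *: PD p v V + PD p v V'.
Proof.
move=> df dV dV'; rewrite /pullback_derivative.
rewrite -(near_eq_vder v (near_comp_lin p f V V')) (vderD _ (mdiff_scale df dV) dV').
rewrite (vder_scale _ df dV) comp_chart_at.
have assoc (x : R) (a A S B S' : 'rV[R]_n) :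
    a + x *: A + B + (x *: S + S') = a + x *: (A + S) + (B + S').
  by rewrite addrACA scalerDr (addrA a).
rewrite -assoc; congr (_ + _); rewrite scaler_sumr -big_split.
by apply: eq_bigr => k _; rewrite /= !mxE scalerDl scalerA.
Qed.

Lemma near_comp0 p : \forall q \near p, 0 = comp (chart_at (F p)) (F q) 0.
Proof.
apply: filterS (nbhs_preimage_dom smF (mem_chart_at (F p))) => q jq.
by have := linear_subE (comp_linear jq) 0 0; rewrite !subrr.
Qed.

Lemma mdiff_along0 p : mdiff_along p (fun=> 0).
Proof. exact: near_eq_mdiff (near_comp0 p) (@mdiff_cst _ _ _ _ p 0). Qed.

Lemma pullback_derivative0 p v : PD p v (fun=> 0) = 0.
Proof.
rewrite /pullback_derivative big1 ?addr0; last by move=> k _; rewrite mxE scale0r.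
by rewrite -(near_eq_vder v (near_comp0 p)) vder_cst.
Qed.

(** Differentiability is proved together with the formula, because the inductive step applies the
    Leibniz rule to the remaining sum. *)
Lemma pullback_derivative_sum p v I (r : seq I) (f : I -> M -> R)
    (V : I -> M -> 'rV[R]_n) :
  (forall k, mdiff p (f k)) -> (forall k, mdiff_along p (V k)) ->
  mdiff_along p (fun q => \sum_(k <- r) f k q *: V k q) /\
  PD p v (fun q => \sum_(k <- r) f k q *: V k q) =
  \sum_(k <- r) (vder p v (f k) *: V k p + f k p *: PD p v (V k)).
Proof.
move=> df dV; elim: r => [|k r [dr IH]].
  under eq_fun do rewrite big_nil; rewrite big_nil.
  by split; [exact: mdiff_along0|exact: pullback_derivative0].
under eq_fun do rewrite big_cons; rewrite big_cons -IH.
split; first exact: (mdiff_along_lin (df k) (dV k) dr).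
exact: (pullback_derivative_lin v (df k) (dV k) dr).
Qed.

Lemma smooth_mdiff_along p V : smooth_along F setT V -> mdiff_along p V.
Proof.
move=> sV.
exact: (smooth_along_mdiff (U := setT) I (mem_chart_at (F p)) sV).
Qed.

Lemma mdiff_along_map U p (Y : N -> 'rV[R]_n) : U (F p) -> smooth_vf U Y ->
  mdiff_along p (Y \o F).
Proof.
move=> Up sY; have jp := mem_chart_at (F p).
exact: (mdiff_map smF (mdiff_vf (U := U) (p := F p) Up jp sY)).
Qed.

(** The definition uses [chart_at (F p)], which jumps with p. Smoothness in p requires the same
    formula in a chart j kept fixed. *)
Lemma pullback_derivative_chart j p v V : dom j (F p) -> smooth_along F setT V ->
  PD p v V = \sum_k (vder p v (fun q => (comp j (F q) (V q)) 0 k) *: coord_vf j k (F p)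
    + (comp j (F p) (V p)) 0 k *: D (F p) (dF p v) (coord_vf j k)).
Proof.
move=> jp sV.
have E : \forall q \near p,
    V q = \sum_k (comp j (F q) (V q)) 0 k *: coord_vf j k (F q).
  by apply: filterS (nbhs_preimage_dom smF jp) => q jq; exact: coord_vf_expand.
rewrite (near_eq_pullback_derivative v E).
have df k : mdiff p (fun q => (comp j (F q) (V q)) 0 k).
  by apply: mdiff_coord; exact: (smooth_along_mdiff (U := setT) I jp sV).
have dc k : mdiff_along p (coord_vf j k \o F).
  exact: mdiff_along_map jp (smooth_vf_coord j k).
have [_ ->] := pullback_derivative_sum v (index_enum _) df dc.
apply: eq_bigr => k _; congr (_ + _ *: _).
exact: pullback_derivative_map (dom_open j) jp (smooth_vf_coord j k).
Qed.

Lemma connection_linear U p (Y : N -> 'rV[R]_n) : open U -> U (F p) ->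
  smooth_vf U Y -> linear (fun w => D (F p) w Y).
Proof. by case: affD => linD _ _ _ oU Up sY; exact: linD oU Up sY. Qed.

Lemma pullback_derivative_linear p V : smooth_along F setT V ->
  linear (fun v => PD p v V).
Proof.
move=> sV a u v; have jp := mem_chart_at (F p).
rewrite /pullback_derivative (vder_linear (@smooth_mdiff_along p _ sV)).
have assoc (A B S S' : 'rV[R]_n) : a *: A + B + (a *: S + S') = a *: (A + S) + (B + S').
  by rewrite addrACA scalerDr.
rewrite -assoc; congr (_ + _); rewrite scaler_sumr -big_split; apply: eq_bigr => k _ /=.
have DL := connection_linear (dom_open _) jp (smooth_vf_coord _ k).
rewrite (tangent_map_linear smF) DL.
by rewrite scalerDr !scalerA (mulrC a).
Qed.

Lemma smooth_pullback_derivative (X : M -> 'rV[R]_m) V : smooth_vf setT X ->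
  smooth_along F setT V -> smooth_along F setT (fun q => PD q (X q) V).
Proof.
move=> sX sV j; have oj := open_preimage_map smF (dom_open j).
have sXj : smooth_vf (F @^-1` dom j) X by apply: smooth_vf_subset sX.
have sP := smooth_along_push smF openT sX j; rewrite setTI in sP.
have sVj := sV j; rewrite setTI in sVj; rewrite setTI.
have sVk k := smooth_on_coord k oj sVj.
(* The Christoffel symbols of [D] in the chart j, composed with F. *)
have sDD k l : smooth_on (F @^-1` dom j)
    (fun q => comp j (F q) (D (F q) (coord_vf j l (F q)) (coord_vf j k))).
  case: affD => _ _ _ smD.
  have := smD _ _ _ (dom_open j) (smooth_vf_coord j l) (smooth_vf_coord j k).
  move=> /(_ j); rewrite setIid => sD.
  exact: (smooth_on_map smF (dom_open j) sD).
have H : smooth_on (F @^-1` dom j) (fun q => \sum_k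
   (vder q (X q) (fun q => (comp j (F q) (V q)) 0 k) *: ('e_k : 'rV[R]_n) +
    (comp j (F q) (V q)) 0 k *: \sum_l (comp j (F q) (push F X q)) 0 l *:
      comp j (F q) (D (F q) (coord_vf j l (F q)) (coord_vf j k)))).
  apply: smooth_on_sum => // k; apply: (smooth_onD oj).
    apply: (smooth_on_scale oj); last exact: smooth_on_cst.
    exact: smooth_on_vder oj (sVk k) sXj.
  apply: (smooth_on_scale oj (sVk k)); apply: smooth_on_sum => // l.
  exact: (smooth_on_scale oj (smooth_on_coord l oj sP) (sDD k l)).
apply: eq_smooth_on oj _ H => q jq.
rewrite (pullback_derivative_chart _ jq sV) [in RHS]big_split [RHS]/=.
have C1 (u w : 'rV[R]_n) : comp j (F q) (u + w) = comp j (F q) u + comp j (F q) w.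
  by have := comp_linear jq 1 u w; rewrite !scale1r.
rewrite C1 !(comp_sum _ _ _ jq) -big_split; apply: eq_bigr => k _.
rewrite (comp_coord_vf_diag _ jq); congr (_ + _ *: _).
rewrite -(comp_sum _ _ _ jq); congr (comp j (F q) _).
rewrite -(linear_sumZ (connection_linear (dom_open j) jq (smooth_vf_coord j k))).
by rewrite -coord_vf_expand.
Qed.

End PullbackDerivative.

(** * Torsion of the pulled-back Levi-Civita connection *)

Section Torsion.
Context {R : realType} {n m : nat} (N : smooth_manifold R n)
  (M : smooth_manifold R m) (F : M -> N) (smF : smooth_map F)
  (g : N -> 'rV[R]_n -> 'rV[R]_n -> R) (D : connection N)
  (lcD : levi_civita g D).

Lemma levi_civita_affine : affine_connection D.
Proof. by case: lcD. Qed.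

(** The components of a coordinate field in its own chart are constant, so two such fields have zero
    bracket; vanishing torsion then makes the Christoffel symbols symmetric. *)
Lemma coord_vf_torsion (q : N) (k l : 'I_n) : let j := chart_at q in
  D q (coord_vf j l q) (coord_vf j k) = D q (coord_vf j k q) (coord_vf j l).
Proof.
move=> j; case: lcD => _ tf _; have jq : dom j q := mem_chart_at q.
apply/eqP; rewrite -subr_eq0; apply/eqP.
rewrite (tf _ _ _ _ (dom_open j) jq (smooth_vf_coord j l) (smooth_vf_coord j k)).
have comp_cst a : \forall q' \near q, comp j q' (coord_vf j a q') = 'e_a.
  by apply: filterS (nbhs_dom jq) => q' jq'; rewrite comp_coord_vf_diag.
have vcomp v a : vder q v (fun q' => comp j q' (coord_vf j a q')) = 0.
  by rewrite (near_eq_vder v (comp_cst a)) vder_cst.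
exact: (etrans (congr2 (fun a b => a - b) (vcomp _ k) (vcomp _ l)) (subrr _)).
Qed.

(** The Christoffel terms cancel by symmetry. What remains is the commutator of X and Y on chart j
    \o F, that is, the derivative of this map along the bracket, which is [tangent_map] by
    definition. *)
Lemma pullback_derivative_torsion (p : M) (X Y : M -> 'rV[R]_m) :
  smooth_vf setT X -> smooth_vf setT Y ->
  pullback_derivative F D p (X p) (push F Y) -
  pullback_derivative F D p (Y p) (push F X) = tangent_map F p (lie_bracket X Y p).
Proof.
move=> sX sY; rewrite /pullback_derivative; set j := chart_at (F p).
have jp : dom j (F p) := mem_chart_at (F p).
have pushE (Z : M -> 'rV[R]_m) : \forall q \near p,
    comp j (F q) (push F Z q) = vder q (Z q) (chart j \o F).
  by apply: filterS (nbhs_preimage_dom smF jp) => q jq; rewrite comp_tangent_map.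
rewrite (near_eq_vder _ (pushE Y)) (near_eq_vder _ (pushE X)).
have DE v (Z : M -> 'rV[R]_m) :
    \sum_k push F Z p 0 k *: D (F p) (tangent_map F p v) (coord_vf j k) =
    \sum_k \sum_l ((push F Z p) 0 k * (tangent_map F p v) 0 l) *:
      D (F p) (coord_vf j l (F p)) (coord_vf j k).
  apply: eq_bigr => k _; rewrite {1}(coord_vf_expand (tangent_map F p v) jp).
  have DL := connection_linear levi_civita_affine (dom_open j) jp
    (smooth_vf_coord j k).
  rewrite (linear_sumZ DL).
  rewrite scaler_sumr; apply: eq_bigr => l _.
  by rewrite scalerA comp_chart_at.
have sym a b : D (F p) (coord_vf j b (F p)) (coord_vf j a) =
    D (F p) (coord_vf j a (F p)) (coord_vf j b) by exact: coord_vf_torsion.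
pose S a b := D (F p) (coord_vf j b (F p)) (coord_vf j a).
have symE := etrans (DE (Y p) X)
  (etrans (sum_sym_swap (S := S) sym _ _) (esym (DE (X p) Y))).
have cancel (a b d e : 'rV[R]_n) : e = b -> a + b - (d + e) = a - d.
  by move=> ->; rewrite opprD addrACA subrr addr0.
apply: (etrans (cancel _ _ _ _ symE)).
have [_ /(_ j) sj] := smF.
have oj := open_preimage_map smF (dom_open j).
have sXj : smooth_vf (F @^-1` dom j) X := smooth_vf_subset (@subsetT _ _) sX.
have sYj : smooth_vf (F @^-1` dom j) Y := smooth_vf_subset (@subsetT _ _) sY.
exact: (vder_lie_bracket oj jp sj sXj sYj).
Qed.

End Torsion.

(** * Tangential and normal parts *)

Section Lorentz.
Context {R : realType} {n : nat} (N : smooth_manifold R n)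
  (g : N -> 'rV[R]_n -> 'rV[R]_n -> R) (gL : lorentzian_metric g).

Lemma metric_linear_r (q : N) u : scalar (g q u).
Proof. by case: gL => -[gr [gl _]] _. Qed.

Lemma metric_linear_l (q : N) u : scalar (g q ^~ u).
Proof. by case: gL => -[gr [gl _]] _. Qed.

Lemma metric_sym (q : N) u v : g q u v = g q v u.
Proof. by case: gL => _ []. Qed.

(** In a frame orthonormal at q, t = u_0 w - w_0 u has no time component, so g(t, t) >= 0; but g(t,
    t) = - u_0^2. Hence u_0 = 0, and g(u, u) = 0 is a vanishing sum of squares. *)
Lemma lorentz_spacelike (q : N) (u w : 'rV[R]_n) :
  g q w w = -1 -> g q u w = 0 -> g q u u = 0 -> u = 0.
Proof.
case: (gL) => _ [_ /(_ q) [P [uP PE]]].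
pose s (a : 'I_n) : R := if val a == 0%N then -1 else 1.
have gE (c : 'rV[R]_n) : g q (c *m P) (c *m P) = \sum_a c 0 a ^+ 2 * s a.
  rewrite [in LHS]mulmx_sum_row (linear_sumZ (@metric_linear_l q _)).
  apply: eq_bigr => a _; rewrite (linear_sumZ (@metric_linear_r q _)).
  rewrite (bigD1 a) //= big1 => [|b ba]; last first.
    by rewrite PE eq_sym (negPf ba) scaler0.
  by rewrite PE eqxx addr0 /s [_ *: _]mulrA expr2.
move=> ww uw uu; have [n0|n0] := posnP n.
  by apply/rowP => -[a an]; exfalso; move: an; rewrite n0.
pose i0 : 'I_n := Ordinal n0.
have gEpos (c : 'rV[R]_n) : c 0 i0 = 0 -> g q (c *m P) (c *m P) = \sum_a c 0 a ^+ 2.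
  move=> c0; rewrite gE; apply: eq_bigr => a _; rewrite /s.
  case: eqP => [a0|_]; last by rewrite mulr1.
  by rewrite (_ : a = i0) ?c0 ?expr0n ?mul0r //; exact: val_inj.
pose cu := u *m invmx P; pose cw := w *m invmx P.
have uE : u = cu *m P by rewrite mulmxKV.
have wE : w = cw *m P by rewrite mulmxKV.
have cu0 : cu 0 i0 = 0.
  pose t := cu 0 i0 *: w + (- cw 0 i0) *: u.
  pose ct := cu 0 i0 *: cw + (- cw 0 i0) *: cu.
  have tE : t = ct *m P by rewrite /t wE uE mulmxDl -!scalemxAl.
  have ct0 : ct 0 i0 = 0 by rewrite !mxE; ring.
  have tt : g q t t = - cu 0 i0 ^+ 2.
    have lin_l (a : R) v (b : R) v' x :
        g q (a *: v + b *: v') x = a * g q v x + b * g q v' x.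
      by have := linear_sumZ (@metric_linear_l q x) [:: (a, v); (b, v')]
        (fun z => z.1) (fun z => z.2); rewrite !big_cons !big_nil !addr0.
    have lin_r (a : R) v (b : R) v' x :
        g q x (a *: v + b *: v') = a * g q x v + b * g q x v'.
      by rewrite metric_sym lin_l !(metric_sym _ _ x).
    rewrite /t lin_l !lin_r ww uu uw (metric_sym q w u) uw; ring.
  have : 0 <= g q t t by rewrite tE (gEpos _ ct0) sumr_ge0 // => a _; exact: sqr_ge0.
  by rewrite tt oppr_ge0 le_eqVlt sqrf_eq0 ltNge sqr_ge0 orbF => /eqP.
have sum0 : \sum_a cu 0 a ^+ 2 = 0 by rewrite -gEpos // -uE.
have /psumr_eq0P H : forall a : 'I_n, true -> 0 <= cu 0 a ^+ 2.
  by move=> a _; exact: sqr_ge0.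
rewrite uE (_ : cu = 0) ?mul0mx //; apply/rowP => a.
rewrite [RHS]mxE; apply/eqP; rewrite -sqrf_eq0; apply/eqP; exact: H sum0 a isT.
Qed.

End Lorentz.

Section TangentialPart.
Context {R : realType} {n m : nat} (N : smooth_manifold R n)
  (M : smooth_manifold R m) (F : M -> N)
  (g : N -> 'rV[R]_n -> 'rV[R]_n -> R) (xi : N -> 'rV[R]_n).
Hypotheses (immF : immersion F) (gL : lorentzian_metric g)
  (xi_tangent : forall p, is_tangent F p (xi (F p)))
  (xi_unit : forall q, g q (xi q) (xi q) = -1).
Implicit Types (p : M).

Local Notation dF := (tangent_map F).

Lemma immersion_smooth : smooth_map F. Proof. by case: immF. Qed.

Let smF := immersion_smooth.

Lemma is_normal_lin p (a : R) w w' : is_normal F g p w -> is_normal F g p w' ->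
  is_normal F g p (a *: w + w').
Proof. by move=> nw nw' v; rewrite (metric_linear_r gL) nw nw' mulr0 addr0. Qed.

Lemma is_normalB p w w' : is_normal F g p w -> is_normal F g p w' ->
  is_normal F g p (w - w').
Proof. by move=> nw nw'; rewrite addrC -scaleN1r; exact: is_normal_lin. Qed.

(** A tangent vector that is also normal is orthogonal to itself and to the tangent vector xi; so it
    vanishes by [lorentz_spacelike], and dF is injective. *)
Lemma tangent_nondegenerate p v : is_normal F g p (dF p v) -> v = 0.
Proof.
move=> nv; have [_ /(_ p) inj] := immF; have [x xE] := xi_tangent p.
apply: inj; have L := tangent_map_linear smF p.
rewrite -[in RHS](subrr v) (linear_subE L) subrr.
apply: (lorentz_spacelike gL (xi_unit (F p))); last exact: nv.
by rewrite (metric_sym gL) xE; exact: nv.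
Qed.

Lemma is_normal_coord i p w : dom i p ->
  (forall a, g (F p) (dF p (coord_vf i a p)) w = 0) -> is_normal F g p w.
Proof.
move=> ip nw v; rewrite (coord_vf_expand v ip) (linear_sumZ (tangent_map_linear smF p)).
rewrite (linear_sumZ (metric_linear_l gL _ w)) big1 // => a _.
by rewrite nw scaler0.
Qed.

Definition gram i p : 'M[R]_m := \matrix_(a, b)
  g (F p) (dF p (coord_vf i a p)) (dF p (coord_vf i b p)).

Lemma gramE i p a b :
  gram i p a b = g (F p) (dF p (coord_vf i a p)) (dF p (coord_vf i b p)).
Proof. by rewrite /gram mxE. Qed.

(** A row u in the kernel gives a tangent vector sum u_a d_a orthogonal to every coordinate vector,
    hence zero; its components u are then zero. *)
Lemma gram_unit i p : dom i p -> gram i p \in unitmx.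
Proof.
move=> ip; rewrite -row_free_unit; apply: inj_row_free => u uG.
have v0 : \sum_a u 0 a *: coord_vf i a p = 0.
  apply: (@tangent_nondegenerate p); apply: (is_normal_coord ip) => b.
  rewrite (linear_sumZ (tangent_map_linear smF p)) (linear_sumZ (metric_linear_r gL _ _)).
  have := congr1 (fun z : 'rV_m => z 0 b) uG; rewrite !mxE => uGb.
  rewrite -[RHS]uGb; apply: eq_bigr => a _.
  exact: (congr1 (fun z => u 0 a * z)
    (etrans (metric_sym gL _ _ _) (esym (gramE i p a b)))).
have := congr1 (comp i p) v0; rewrite (comp_sum _ _ _ ip) => uE.
rewrite [LHS]row_sum_delta.
rewrite (eq_bigr (fun a => u 0 a *: comp i p (coord_vf i a p))); last first.
  by move=> a _; rewrite comp_coord_vf_diag.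
by rewrite uE; have := linear_subE (comp_linear ip) 0 0; rewrite !subrr.
Qed.

(** [xget] picks some solution; the difference of two solutions is tangent and normal at once. *)
Lemma tan_part_unique p w v : is_normal F g p (w - dF p v) -> tan_part F g p w = v.
Proof.
move=> nv; have nt : is_normal F g p (w - dF p (tan_part F g p w)).
  exact: (@xgetPex _ 0 [set v | is_normal F g p (w - dF p v)] (ex_intro _ v nv)).
apply/eqP; rewrite -subr_eq0; apply/eqP; apply: (@tangent_nondegenerate p).
rewrite (linear_subE (tangent_map_linear smF p)).
have := is_normalB nv nt.
by rewrite opprB addrC addrA subrK.
Qed.

(** The solution x of the normal equations x G = (g(dF d_b, w))_b: the components in i of the
    orthogonal projection of w to the tangent space. *)
Definition gram_part i p w : 'rV[R]_m :=
  \row_b g (F p) (dF p (coord_vf i b p)) w *m invmx (gram i p).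

Lemma gram_part_normal i p w : dom i p ->
  is_normal F g p (w - dF p (\sum_a gram_part i p w 0 a *: coord_vf i a p)).
Proof.
move=> ip; apply: (is_normal_coord ip) => b.
rewrite (linear_subE (metric_linear_r gL _ _)).
rewrite (linear_sumZ (tangent_map_linear smF p)) (linear_sumZ (metric_linear_r gL _ _)).
apply/eqP; rewrite subr_eq0; apply/eqP.
have := congr1 (fun z : 'rV_m => z 0 b)
  (mulmxKV (gram_unit ip) (\row_b g (F p) (dF p (coord_vf i b p)) w)).
rewrite [in RHS]mxE => <-; rewrite mxE; apply: eq_bigr => a _.
exact: (congr1 (fun z => gram_part i p w 0 a * z)
  (etrans (gramE i p a b) (metric_sym gL _ _ _))).
Qed.

Lemma tan_part_gram i p w : dom i p ->
  tan_part F g p w = \sum_a gram_part i p w 0 a *: coord_vf i a p.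
Proof. by move=> ip; apply: tan_part_unique; exact: gram_part_normal. Qed.

Lemma nor_part_normal p w : is_normal F g p (nor_part F g p w).
Proof.
have ip := mem_chart_at p; rewrite /nor_part (tan_part_gram _ ip).
exact: gram_part_normal.
Qed.

Lemma tan_part_tangent p v : tan_part F g p (dF p v) = v.
Proof.
apply: tan_part_unique; rewrite subrr => u.
by have := linear_subE (metric_linear_r gL (F p) (dF p u)) 0 0; rewrite !subrr.
Qed.

Lemma nor_part_tangent p v : nor_part F g p (dF p v) = 0.
Proof. by rewrite /nor_part tan_part_tangent subrr. Qed.

Lemma tan_part_linear p : linear (tan_part F g p).
Proof.
move=> a w w'; apply: tan_part_unique; rewrite (tangent_map_linear smF p).
have regroup (x t x' t' : 'rV[R]_n) :
    a *: (x - t) + (x' - t') = a *: x + x' - (a *: t + t').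
  by rewrite scalerBr opprD addrACA.
by rewrite -regroup; apply: is_normal_lin; exact: nor_part_normal.
Qed.

Lemma nor_part_linear p : linear (nor_part F g p).
Proof.
move=> a w w'; rewrite /nor_part tan_part_linear (tangent_map_linear smF p).
have regroup (x t x' t' : 'rV[R]_n) :
    a *: (x - t) + (x' - t') = a *: x + x' - (a *: t + t').
  by rewrite scalerBr opprD addrACA.
exact: esym (regroup _ _ _ _).
Qed.

Lemma nor_part0 p : nor_part F g p 0 = 0.
Proof. by have := linear_subE (nor_part_linear p) 0 0; rewrite !subrr. Qed.

Lemma smooth_tan_part V : smooth_along F setT V ->
  smooth_vf setT (fun p => tan_part F g p (V p)).
Proof.
move=> sV i; rewrite setIT; have oi := dom_open i.
have sVi : smooth_along F (dom i) V.
  by move=> j; apply: smooth_on_subset (sV j) => q [_ jq].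
have sE b := smooth_along_push smF oi (smooth_vf_coord i b).
have gT : tensor02 g by case: gL.
have sG a b : smooth_on (dom i) (fun q => gram i q a b).
  under eq_fun do rewrite gramE.
  exact: (smooth_on_tensor02 smF oi gT (sE a) (sE b)).
have uG q : dom i q -> gram i q \in unitmx by exact: gram_unit.
have sI a b := smooth_on_invmx a b oi uG sG.
have sb b : smooth_on (dom i) (fun q =>
    (\row_b g (F q) (dF q (coord_vf i b q)) (V q)) 0 b).
  under eq_fun do rewrite mxE.
  exact: (smooth_on_tensor02 smF oi gT (sE b) sVi).
have H : smooth_on (dom i) (fun q => gram_part i q (V q)).
  apply: (smooth_on_row oi) => a; under eq_fun do rewrite mxE.
  by apply: (smooth_on_sum _ oi) => b; exact: (smooth_onM oi (sb b) (sI b a)).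
apply: (eq_smooth_on oi _ H) => q iq.
rewrite (tan_part_gram _ iq) (comp_sum _ _ _ iq) [LHS]row_sum_delta.
by apply: eq_bigr => a _; rewrite (comp_coord_vf_diag _ iq).
Qed.

End TangentialPart.

(** * Invariant submanifolds *)

Section InvariantSubmanifold.
Context {R : realType} {n m : nat} (N : smooth_manifold R n)
  (M : smooth_manifold R m) (F : M -> N)
  (g : N -> 'rV[R]_n -> 'rV[R]_n -> R) (D : connection N) (xi : N -> 'rV[R]_n)
  (alpha : N -> R).
Hypotheses (lcsN : lcs_manifold g D xi alpha) (invF : invariant_submanifold F g xi).
Implicit Types (p : M) (X Y Z W : M -> 'rV[R]_m).

Local Notation dF := (tangent_map F).
Local Notation PD := (pullback_derivative F D).
Local Notation eta := (eta g xi).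
Local Notation phi := (phi g xi).
Local Notation Dq := (quarter_symmetric g D xi).
Local Notation q_nabla := (q_nabla F g D xi).
Local Notation q_nabla_perp := (q_nabla_perp F g D xi).
Local Notation q_Dsigma := (q_Dsigma F g D xi).
Local Notation q_D2sigma := (q_D2sigma F g D xi).
Local Notation sigma := (sigma F g D).

Let gL : lorentzian_metric g. Proof. by case: lcsN. Qed.
Let gT : tensor02 g. Proof. by case: gL. Qed.
Let lcD : levi_civita g D. Proof. by case: lcsN. Qed.
Let affD : affine_connection D := levi_civita_affine lcD.
Let sxi : smooth_vf setT xi. Proof. by case: lcsN => _ _ []. Qed.
Let xi_unit q : g q (xi q) (xi q) = -1. Proof. by case: lcsN => _ _ []. Qed.
Let immF : immersion F. Proof. by case: invF. Qed.
Let smF : smooth_map F := immersion_smooth immF.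
Let xiT p : is_tangent F p (xi (F p)). Proof. by case: invF. Qed.

Let nabla_xi q v : D q v xi = alpha q *: phi q v.
Proof. by case: lcsN => _ _ _ _ [H _]; exact: H. Qed.

(** The field on M that [tangent_map] sends to xi. Taking it as a tangential part, and not as chosen
    preimages, makes its smoothness a case of [smooth_tan_part]. *)
Definition xi_sub p : 'rV[R]_m := tan_part F g p (xi (F p)).

Lemma push_xi_sub : push F xi_sub = xi \o F.
Proof.
apply/funext => p; rewrite /push /xi_sub /=; have [x xE] := xiT p.
by rewrite xE (tan_part_tangent immF gL xiT xi_unit).
Qed.

Lemma tangent_xi_sub p : dF p (xi_sub p) = xi (F p).
Proof. by have := congr1 (fun V => V p) push_xi_sub. Qed.

Lemma smooth_xi_sub : smooth_vf setT xi_sub.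
Proof.
exact: (smooth_tan_part immF gL xiT xi_unit (smooth_along_map smF sxi)).
Qed.

(** The quarter symmetric correction is linear in the value of the field, so its sum over the
    coordinate fields with weights V^k is its value at V p; the derivative of the components is
    common to both sides. *)
Lemma pullback_quarter_symmetric p v V :
  pullback_derivative F Dq p v V =
  PD p v V + eta (F p) (V p) *: phi (F p) (dF p v)
  - g (F p) (phi (F p) (dF p v)) (V p) *: xi (F p).
Proof.
rewrite /pullback_derivative -!addrA; congr (_ + _).
set w := dF p v; set c := phi (F p) w.
have vE : V p = \sum_k V p 0 k *: coord_vf (chart_at (F p)) k (F p).
  rewrite [LHS]row_sum_delta; apply: eq_bigr => k _.
  by rewrite coord_vf_chart_at.
have etaE : eta (F p) (V p) =
    \sum_k V p 0 k * eta (F p) (coord_vf (chart_at (F p)) k (F p)).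
  by rewrite {1}vE /Defs.eta (linear_sumZ (metric_linear_l gL _ _)).
have gE : g (F p) c (V p) =
    \sum_k V p 0 k * g (F p) c (coord_vf (chart_at (F p)) k (F p)).
  by rewrite {1}vE (linear_sumZ (metric_linear_r gL _ _)).
rewrite etaE gE !scaler_suml -sumrB -big_split; apply: eq_bigr => k _ /=.
rewrite /quarter_symmetric -/c.
have distr (t a b : R) (A B C : 'rV[R]_n) :
    t *: (A + a *: B - b *: C) = t *: A + ((t * a) *: B - (t * b) *: C).
  by rewrite -addrA scalerDr scalerBr !scalerA.
exact: distr.
Qed.

Lemma phi_tangent p v : phi (F p) (dF p v) = dF p (v + eta (F p) (dF p v) *: xi_sub p).
Proof.
rewrite [v + _]addrC (tangent_map_linear smF) tangent_xi_sub.
exact: addrC.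
Qed.

Lemma smooth_q_nabla X Y : smooth_vf setT X -> smooth_vf setT Y ->
  smooth_vf setT (q_nabla X Y).
Proof.
move=> sX sY; apply: (smooth_tan_part immF gL xiT xi_unit).
have sPX := smooth_along_push smF openT sX.
have sPY := smooth_along_push smF openT sY.
have sxiF := smooth_along_map smF sxi.
have seta Z : smooth_vf setT Z -> smooth_on setT (fun q => eta (F q) (push F Z q)).
  move=> sZ.
  exact: (smooth_on_tensor02 smF openT gT (smooth_along_push smF openT sZ) sxiF).
have sphi : smooth_along F setT (fun q => phi (F q) (push F X q)).
  apply: (smooth_alongD smF openT sPX).
  exact: (smooth_along_scale smF openT (seta X sX) sxiF).
have sgphi := smooth_on_tensor02 smF openT gT sphi sPY.
have sPD := smooth_pullback_derivative smF affD sX sPY.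
have H := smooth_alongD smF openT
  (smooth_alongD smF openT sPD (smooth_along_scale smF openT (seta Y sY) sphi))
  (smooth_along_scale smF openT (smooth_onN openT sgphi) sxiF).
apply: (eq_ind _ (smooth_along F setT) H); apply/funext => q.
by rewrite pullback_quarter_symmetric scaleNr.
Qed.

(** * The second fundamental form along the structure field *)

Lemma sigma_xi_r X p : sigma X xi_sub p = 0.
Proof.
rewrite /Defs.sigma push_xi_sub (pullback_derivative_map smF affD _ openT I sxi).
rewrite nabla_xi phi_tangent -(linear_scaleE (tangent_map_linear smF p)).
exact: (nor_part_tangent immF gL xiT xi_unit).
Qed.

Lemma sigma_sym X Y p : smooth_vf setT X -> smooth_vf setT Y ->
  sigma X Y p = sigma Y X p.
Proof.
move=> sX sY; apply/eqP; rewrite -subr_eq0; apply/eqP.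
have L := nor_part_linear immF gL xiT xi_unit p.
apply: (etrans (esym (linear_subE L _ _))).
rewrite (pullback_derivative_torsion smF lcD p sX sY).
exact: (nor_part_tangent immF gL xiT xi_unit).
Qed.

Lemma sigma_xi_l X p : smooth_vf setT X -> sigma xi_sub X p = 0.
Proof. by move=> sX; rewrite (sigma_sym p smooth_xi_sub sX) sigma_xi_r. Qed.

(** The pull-back derivative is linear in the direction, so [sigma] depends on its first field
    through the value at p, and a, b may be constants frozen there. The shape of the combination is
    that of [q_nabla_xi]. *)
Lemma sigma_pointwise_linear X X' X'' Y p (a b : R) : smooth_vf setT Y ->
  X p = a *: (X' p + b *: X'' p) ->
  sigma X Y p = a *: (sigma X' Y p + b *: sigma X'' Y p).
Proof.
move=> sY XE; have L := nor_part_linear immF gL xiT xi_unit p.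
have PL := pullback_derivative_linear smF affD p (smooth_along_push smF openT sY).
rewrite /Defs.sigma XE (linear_scaleE PL) addrC PL.
by rewrite (linear_scaleE L) L addrC.
Qed.

Lemma q_nabla_xi X p :
  q_nabla X xi_sub p = (alpha (F p) - 1) *: (X p + eta (F p) (dF p (X p)) *: xi_sub p).
Proof.
rewrite /Defs.q_nabla push_xi_sub pullback_quarter_symmetric.
rewrite (pullback_derivative_map smF affD _ openT I sxi) nabla_xi /=.
(* As xi has square -1, the two terms of phi cancel against xi. *)
have -> : g (F p) (phi (F p) (dF p (X p))) (xi (F p)) = 0.
  rewrite /Defs.phi [dF p _ + _]addrC (metric_linear_l gL) xi_unit.
  by rewrite mulrN1 addNr.
have -> : eta (F p) (xi (F p)) = -1 by exact: xi_unit.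
rewrite scale0r subr0 -scalerDl.
rewrite phi_tangent -(linear_scaleE (tangent_map_linear smF p)).
exact: (tan_part_tangent immF gL xiT xi_unit).
Qed.

(** The derivative sees V around p, hence the vanishing at all points; the quarter symmetric terms
    vanish with V p. *)
Lemma q_nabla_perp0 X V p : (forall q, V q = 0) -> q_nabla_perp X V p = 0.
Proof.
move=> V0; rewrite /Defs.q_nabla_perp pullback_quarter_symmetric.
rewrite (_ : V = fun=> 0); last exact/funext.
rewrite (pullback_derivative0 smF D).
have g0 q u : g q u 0 = 0.
  by have := linear_subE (metric_linear_r gL q u) 0 0; rewrite !subrr.
rewrite /Defs.eta (metric_sym gL (F p) 0) !g0 !scale0r addr0 subr0.
exact: (nor_part0 immF gL xiT xi_unit).
Qed.

(** * The two implications *)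

Lemma totally_geodesic_recurrent :
  totally_geodesic F g D -> generalized_2_recurrent F g D xi.
Proof.
move=> tg.
have Ds0 X Y Z p : smooth_vf setT X -> smooth_vf setT Y -> smooth_vf setT Z ->
    q_Dsigma X Y Z p = 0.
  move=> sX sY sZ; rewrite /Defs.q_Dsigma q_nabla_perp0; last by move=> q; exact: tg.
  (* [totally_geodesic] is a statement on smooth fields; [smooth_q_nabla] brings the corrections
     under it. *)
  rewrite (tg _ _ (smooth_q_nabla sX sY) sZ p) (tg _ _ sY (smooth_q_nabla sX sZ) p).
  by rewrite !subr0.
exists (fun _ _ _ => 0), (fun _ _ => 0); split.
  split; [|split]; first by move=> p u a v w; rewrite mulr0 addr0.
    by move=> p u a v w; rewrite mulr0 addr0.
  by move=> U X Y _ _ _; exact: smooth_on_cst.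
split.
  split; first by move=> p a v w; rewrite mulr0 addr0.
  by move=> U X _ _; exact: smooth_on_cst.
move=> X Y Z W sX sY sZ sW p; rewrite !scale0r addr0 /Defs.q_D2sigma.
have sN := smooth_q_nabla.
rewrite q_nabla_perp0; last by move=> q; exact: Ds0.
rewrite (Ds0 _ _ _ p sY (sN _ _ sX sZ) sW) (Ds0 _ _ _ p sX sZ (sN _ _ sY sW)).
by rewrite (Ds0 _ _ _ p (sN _ _ sX sY) sZ sW) !subr0.
Qed.

(** Every term of the derivative keeps xi in at least one slot. *)
Lemma q_Dsigma_xi_xi X p : smooth_vf setT X -> q_Dsigma X xi_sub xi_sub p = 0.
Proof.
move=> sX; rewrite /Defs.q_Dsigma q_nabla_perp0; last by move=> q; exact: sigma_xi_r.
by rewrite sigma_xi_r (sigma_xi_l p (smooth_q_nabla sX smooth_xi_sub)) !subr0.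
Qed.

Lemma q_D2sigma_xi_xi X Y p : smooth_vf setT X -> smooth_vf setT Y ->
  q_D2sigma X Y xi_sub xi_sub p = sigma (q_nabla X xi_sub) (q_nabla Y xi_sub) p *+ 2.
Proof.
move=> sX sY; have sN := smooth_q_nabla; have sxs := smooth_xi_sub.
have sNX := sN _ _ sX sxs; have sNY := sN _ _ sY sxs.
rewrite /Defs.q_D2sigma q_nabla_perp0; last by move=> q; exact: q_Dsigma_xi_xi.
rewrite (q_Dsigma_xi_xi _ (sN _ _ sX sY)) sub0r subr0.
rewrite /Defs.q_Dsigma q_nabla_perp0; last by move=> q; exact: sigma_xi_r.
rewrite q_nabla_perp0; last by move=> q; exact: sigma_xi_l.
(* Here s is sigma at the two derivatives of xi. It comes once from each of the two corrections
   left, whose other terms r and t keep xi in a slot. *)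
have regroup (r s t : 'rV[R]_n) : r = 0 -> t = 0 ->
    - (0 - r - s) - (0 - s - t) = s *+ 2.
  by move=> -> ->; rewrite !subr0 !sub0r !opprK.
exact: regroup (sigma_xi_r (q_nabla Y (q_nabla X xi_sub)) p)
  (sigma_xi_l p (sN _ _ sX sNY)).
Qed.

(** Linearity is applied in the first slot, then symmetry brings the other derivative of xi to the
    front. *)
Lemma sigma_q_nabla_xi X Y p : smooth_vf setT X -> smooth_vf setT Y ->
  sigma (q_nabla X xi_sub) (q_nabla Y xi_sub) p =
  (alpha (F p) - 1) ^+ 2 *: sigma X Y p.
Proof.
move=> sX sY; have sNY := smooth_q_nabla sY smooth_xi_sub.
have E Z W : smooth_vf setT W ->
    sigma (q_nabla Z xi_sub) W p = (alpha (F p) - 1) *: sigma Z W p.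
  move=> sW; rewrite (sigma_pointwise_linear sW (q_nabla_xi Z p)).
  by rewrite (sigma_xi_l p sW) scaler0 addr0.
by rewrite (E X _ sNY) (sigma_sym p sX sNY) (E Y _ sX) scalerA -expr2 (sigma_sym p sY sX).
Qed.

Lemma recurrent_totally_geodesic : (forall p, alpha (F p) <> 1) ->
  generalized_2_recurrent F g D xi -> totally_geodesic F g D.
Proof.
move=> alpha1 [psi [pi1 [_ [_ rec]]]] X Y sX sY p.
have sxs := smooth_xi_sub.
have := rec X Y xi_sub xi_sub sX sY sxs sxs p.
rewrite sigma_xi_r q_Dsigma_xi_xi // !scaler0 addr0 q_D2sigma_xi_xi //.
rewrite sigma_q_nabla_xi // -scaler_nat scalerA => /eqP.
(* The scalar is 2 (alpha - 1)^2, and 2 is nonzero in R. *)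
rewrite scaler_eq0 mulf_eq0 pnatr_eq0 /= sqrf_eq0 subr_eq0.
by case/orP=> /eqP // /alpha1.
Qed.

End InvariantSubmanifold.

Theorem theorem5p3 (R : realType) (n m : nat)
    (N : smooth_manifold R n) (g : N -> 'rV[R]_n -> 'rV[R]_n -> R)
    (D : connection N) (xi : N -> 'rV[R]_n) (alpha : N -> R)
    (M : smooth_manifold R m) (F : M -> N)
    (hmn : (m < n)%N)
    (hN : lcs_manifold g D xi alpha)
    (hM : invariant_submanifold F g xi)
    (halpha : forall p : M, alpha (F p) <> 1) :
  generalized_2_recurrent F g D xi <-> totally_geodesic F g D.
Proof.
split; first exact: (recurrent_totally_geodesic hN hM halpha).
exact: (totally_geodesic_recurrent hN hM).
Qed.
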